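(* There is an absolute (small) constant $b_0>0$ such that the following holds. Let $\lambda>0$. The following statements hold for all finite connected transitive graphs $\mathbb G$ (with $V$ vertices of degree $\Omega$), provided the triangle condition $\nabla_{p_c}(x,y)\le\delta_{x,y}+a_0$ (for all $x,y\in\mathbb V$) holds at $p_c=p_c(\mathbb G,\lambda)$ for some constant $a_0\le b_0$, and $\lambda V^{1/3}\ge b_0^{-1}$. Let $p=p_c+\epsilon\Omega^{-1}\in[0,1]$ with $\epsilon\ge0$. (i) $$\mathbb E_p(|\mathcal C_{\max}|)\le21\epsilon V+7V^{2/3},$$ and, for all $\omega>0$, $$\mathbb P_p\Big(|\mathcal C_{\max}|\ge\omega(V^{2/3}+\epsilon V)\Big)\le\frac{21}{\omega}.$$ (ii) $$\chi(p)\le81\big(V^{1/3}+\epsilon^2V\big).$$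
   Context: $\mathbb G=(\mathbb V,\mathbb B)$ is a finite connected graph with vertex set $\mathbb V$ and bond (edge) set $\mathbb B$. It is transitive: for all $x,y\in\mathbb V$ there is a graph automorphism mapping $x$ to $y$. $V=|\mathbb V|$, and $\Omega$ is the common degree of the vertices. In percolation with parameter $p\in[0,1]$ each bond is independently occupied with probability $p$ and vacant otherwise; $\mathbb P_p,\mathbb E_p$ denote probability and expectation. $x\leftrightarrow y$ means there is a path of occupied bonds from $x$ to $y$ (and $x\leftrightarrow x$ always); $\tau_p(x,y)=\mathbb P_p(x\leftrightarrow y)$; $C(x)$ is the set of vertices connected to $x$; $0\in\mathbb V$ is a fixed vertex; $\chi(p)=\mathbb E_p|C(0)|$, a strictly increasing function of $p$ with $\chi(0)=1$, $\chi(1)=V$; $|\mathcal C_{\max}|=\max\{|C(x)|:x\in\mathbb V\}$. The triangle diagram is $\nabla_p(x,y)=\sum_{u,v\in\mathbb V}\tau_p(x,u)\tau_p(u,v)\tau_p(v,y)$, and $\delta_{x,y}$ is $1$ if $x=y$ and $0$ otherwise. For $\lambda>0$, the critical threshold $p_c=p_c(\mathbb G,\lambda)$ is the unique solution of $\chi(p_c)=\lambda V^{1/3}$; it is always assumed that $1<\lambda V^{1/3}<V$, so that $p_c$ is well defined and $0<p_c<1$. *)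

(* Defs.v *)
From HB Require Import structures.
From mathcomp Require Import all_boot all_order all_fingroup all_algebra.
From mathcomp Require Import reals exp.

Set Implicit Arguments.
Unset Strict Implicit.
Unset Printing Implicit Defensive.

Import Order.TTheory GRing.Theory Num.Theory.

Local Open Scope ring_scope.

(* A graph on the vertex set T is given by its set of bonds, each bond being  *)
(* a two-element set of vertices. A percolation configuration is the set w of *)
(* occupied bonds, hence itself a graph on T.                                 *)
Section Graph.
Variable T : finType.
Implicit Types (B w : {set {set T}}) (x y : T).

Definition is_bond_set B : Prop := forall b, b \in B -> #|b| = 2%N.

(* When is_bond_set B holds, adj B is irreflexive: [set x; x] has one element. *)
Definition adj B : rel T := fun x y => [set x; y] \in B.

Definition degree B x : nat := #|[set y | adj B x y]|.

Definition connected_graph B : Prop := forall x y, connect (adj B) x y.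

Definition automorphism B (s : {perm T}) : Prop :=
  forall x y, adj B (s x) (s y) = adj B x y.

Definition transitive_graph B : Prop :=
  forall x y, exists2 s : {perm T}, automorphism B s & s x = y.

Definition cluster w x : {set T} := [set y | connect (adj w) x y].

Definition Cmax w : nat := \max_(x : T) #|cluster w x|.

End Graph.

Section Percolation.
Variables (R : realType) (T : finType) (B : {set {set T}}).
Implicit Types (p lambda : R) (o x y : T).

Definition perc_weight p (w : {set {set T}}) : R :=
  p ^+ #|w| * (1 - p) ^+ #|B :\: w|.

Definition Eperc p (X : {set {set T}} -> R) : R :=
  \sum_(w : {set {set T}} | w \subset B) perc_weight p w * X w.

Definition Pperc p (A : pred {set {set T}}) : R :=
  \sum_(w : {set {set T}} | (w \subset B) && A w) perc_weight p w.

Definition tau p x y : R := Pperc p (fun w => connect (adj w) x y).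

Definition chi o p : R := Eperc p (fun w => #|cluster w o|%:R).

Definition triangle p x y : R :=
  \sum_(u : T) \sum_(v : T) tau p x u * tau p u v * tau p v y.

(* chi o is strictly increasing from 1 to #|T| on [0, 1] when the graph is    *)
(* connected and 1 < #|T|, so this determines pc when the right-hand side of  *)
(* the equation lies strictly between these values.                           *)
Definition is_critical_threshold o lambda (pc : R) : Prop :=
  0 <= pc <= 1 /\ chi o pc = lambda * #|T|%:R `^ (1 / 3).

End Percolation.

(* Main.v *)
From mathcomp Require Import all_boot all_order all_fingroup all_algebra.
From mathcomp Require Import reals exp topology normedtype derive.
From mathcomp Require Import zify ring lra.
Require Import Defs.

(** Write [V] for the number of vertices, [L] for its cube root, [C(x)] for the
    cluster of [x] and [M(p, g)] for the magnetization, the probability that the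
    cluster of a vertex contains a green vertex when every vertex is green with
    probability [g], independently of the bonds. All estimates go through [M].

    _The critical point._ A fork at a vertex [u] consists of two bonds from [u] to
    [v1] and [v2] such that without them [x] is connected to [u] but to no green
    vertex, while [v1] and [v2] lie in two different green clusters. A
    configuration in which both bonds are open determines the fork, so that
    [2 * M] bounds a sum over [u], [v1], [v2] of fork probabilities
    ([open_fork_unique], [sum_open_fork]). Exploring the clusters of [x] and of
    [v1] one after the other, and bounding by the van den Berg-Kesten inequality
    what is lost because the explored vertices are no longer available, one finds
    that the fork probability is close to that of three independent events, the
    error being a triangle diagram ([fork_ge], [fork_inequality]). This reads
    [2 >= kappa * M * ((1 - a) * (1 - g) * M' - 2 * a * M / g)] with [M'] the
    derivative in [g] and [kappa] close to [1]. At a maximum of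
    [(1 - g) * M ^ 2 / g] one has [(1 - g) * M' = M / (2 * g)], whence
    [(1 - g) * M ^ 2 <= (4 + small) * g] for every [g] ([mag_sqrt]).

    _Above the critical point._ A configuration at [p > pc] is one at [pc] plus
    sprinkled bonds, of probability [s] with [Omega * s] about [eps]. Exploring the
    cluster of [x] at [pc], each of its vertices reaches a green vertex through a
    sprinkled bond with probability at most [Omega * s * M(p, g)], and by Harris'
    inequality these possibilities may be treated as independent. Hence
    [M(p, g) <= M(pc, g + Omega * s * M(p, g))] ([mag_sprinkle]). With the square-root
    law this is a quadratic inequality for [M(p, g)], and it gives
    [M(p, g) <= const * eps] when [g] is a small multiple of [eps ^ 2].

    _Cluster sizes._ For [k] a large multiple of [1 / g], the probability that
    [C(x)] has at least [k] vertices is hardly more than [M(p, g)], and [Cmax] is at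
    most [k] plus the number of vertices in clusters of size at least [k]. This
    bounds the mean of [Cmax]. For the susceptibility, a cluster of size [k + 2 * b]
    at [x] contains a cluster of size [k] at [x] and, disjointly, a connected piece
    of size [b] ([cluster_disj]); summing the resulting product bound over [b] gives
    [chi <= E (min (|C|) k) + P (|C| >= k) * (1 + 2 * E Cmax)] ([chi_le_ECmax]).

    _Two regimes._ Summing the triangle condition over one endpoint gives
    [chi(pc) ^ 3 <= 1 + a * V], so [chi(pc)] is a small multiple of [L]. If
    [eps * L] is bounded, the slope of [mag_sprinkle] at [g = 0] shows that [chi(p)]
    is still a small multiple of [L] ([inside_window]). If [eps * L] is large, then
    [1 / eps ^ 2] is negligible against [eps * V], which is what the choice of [k]
    above requires ([above_window]). *)

Set Implicit Arguments.
Unset Strict Implicit.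
Unset Printing Implicit Defensive.

Import Order.TTheory GRing.Theory Num.Theory.
Import numFieldNormedType.Exports.

Local Open Scope ring_scope.

Local Notation conn W := (connect (adj W)).

(** * Product measures on finite sets of coordinates *)

Section ProductMeasure.
Variables (R : realFieldType) (I : finType).
Implicit Types (f : I -> R) (W : {set I}) (s : seq I) (A : pred {set I}).

Definition wt f W : R := \prod_i (if i \in W then f i else 1 - f i).

Definition expect f (X : {set I} -> R) : R := \sum_W wt f W * X W.

Definition prob f A : R := expect f (fun W => (A W)%:R).

Lemma eq_expect f X Y : X =1 Y -> expect f X = expect f Y.
Proof. by move=> XY; apply: eq_bigr => W _; rewrite XY. Qed.

Lemma expectD f X Y : expect f (fun W => X W + Y W) = expect f X + expect f Y.
Proof. by rewrite -big_split; apply: eq_bigr => W _; rewrite mulrDr. Qed.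

Lemma expectZ f c X : expect f (fun W => c * X W) = c * expect f X.
Proof. by rewrite mulr_sumr; apply: eq_bigr => W _; rewrite mulrCA. Qed.

Lemma expectZr f c X : expect f (fun W => X W * c) = expect f X * c.
Proof. by rewrite mulr_suml; apply: eq_bigr => W _; rewrite mulrA. Qed.

Lemma expectB f X Y : expect f (fun W => X W - Y W) = expect f X - expect f Y.
Proof. by rewrite -sumrB; apply: eq_bigr => W _; rewrite mulrBr. Qed.

Lemma expect_sum f (J : finType) (P : pred J) (X : J -> {set I} -> R) :
  expect f (fun W => \sum_(j | P j) X j W) = \sum_(j | P j) expect f (X j).
Proof.
rewrite exchange_big; apply: eq_bigr => W _; exact: mulr_sumr.
Qed.

Lemma expect_const f c : expect f (fun=> c) = c.
Proof.
rewrite /expect -mulr_suml -bigA_distr /=.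
by rewrite big1 ?mul1r // => i _; rewrite addrC subrK.
Qed.

Lemma expect_cst f X c : (forall W, X W = c) -> expect f X = c.
Proof. by move=> /(eq_expect f)->; exact: expect_const. Qed.

Lemma wt_ge0 f W : (forall i, 0 <= f i <= 1) -> 0 <= wt f W.
Proof.
move=> f01; apply: prodr_ge0 => i _; have /andP[f0 f1] := f01 i.
by case: ifP => // _; rewrite subr_ge0.
Qed.

Lemma expect_le f X Y : (forall i, 0 <= f i <= 1) ->
  (forall W, X W <= Y W) -> expect f X <= expect f Y.
Proof. by move=> f01 XY; apply: ler_sum => W _; rewrite ler_wpM2l ?wt_ge0. Qed.

Lemma expect_ge0 f X : (forall i, 0 <= f i <= 1) ->
  (forall W, 0 <= X W) -> 0 <= expect f X.
Proof. by move=> f01 X0; apply: sumr_ge0 => W _; rewrite mulr_ge0 ?wt_ge0. Qed.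

Lemma prob_le f A A' : (forall i, 0 <= f i <= 1) ->
  (forall W, A W -> A' W) -> prob f A <= prob f A'.
Proof.
by move=> f01 AA; apply: expect_le => // W; rewrite ler_nat; case: (A W) (AA W) => // ->.
Qed.

Lemma prob_ge0 f A : (forall i, 0 <= f i <= 1) -> 0 <= prob f A.
Proof. by move=> f01; apply: expect_ge0. Qed.

Lemma prob_le1 f A : (forall i, 0 <= f i <= 1) -> prob f A <= 1.
Proof.
move=> f01; rewrite -[leRHS](expect_const f); apply: expect_le => // W.
by case: (A W).
Qed.

(** Conditioning on the state of one coordinate: the engine of every induction
    on the number of coordinates below. *)
Lemma expect_step f j X :
  expect f X = (1 - f j) * expect f (fun W => X (W :\ j))
             + f j * expect f (fun W => X (j |: W)).
Proof.
pose w' W := \prod_(i | i != j) (if i \in W then f i else 1 - f i).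
have wD W : j \notin W -> wt f W = (1 - f j) * w' W.
  by move=> /negPf jW; rewrite /wt (bigD1 j) //= jW.
have wU W : j \notin W -> wt f (j |: W) = f j * w' W.
  move=> jW; rewrite /wt (bigD1 j) //= setU11; congr (_ * _).
  by apply: eq_bigr => i /negPf ij; rewrite !inE ij.
have split (G : {set I} -> R) :
    \sum_W G W = \sum_(W : {set I} | j \notin W) (G W + G (j |: W)).
  rewrite (bigID (fun W : {set I} => j \in W)) /= addrC big_split /=.
  congr (_ + _).
  rewrite (reindex_onto (fun W : {set I} => j |: W) (fun W : {set I} => W :\ j)) /=.
    apply: eq_bigl => W; rewrite setU11 /=; apply/eqP/idP => [<-|jW].
      by rewrite !inE eqxx.
    by rewrite setU1K.
  by move=> W jW; rewrite setD1K.
rewrite /expect !split !mulr_sumr -big_split; apply: eq_bigr => W jW /=.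
have -> : (j |: W) :\ j = W by rewrite setU1K.
have -> : W :\ j = W by apply/setDidPl; rewrite disjoint_sym disjoints1.
by rewrite setUA setUid wD // wU //; ring.
Qed.

Definition agree s W W' := forall i, i \in s -> (i \in W) = (i \in W').

Definition local U s (X : {set I} -> U) :=
  forall W W', agree s W W' -> X W = X W'.

Lemma local_del U s j (X : {set I} -> U) :
  local (j :: s) X -> local s (fun W => X (W :\ j)).
Proof.
move=> Xl W W' WW; apply: Xl => i; rewrite !inE; case: eqP => //= _.
exact: WW.
Qed.

Lemma local_add U s j (X : {set I} -> U) :
  local (j :: s) X -> local s (fun W => X (j |: W)).
Proof.
move=> Xl W W' WW; apply: Xl => i; rewrite !inE; case: eqP => //= _.
exact: WW.
Qed.

Lemma local_enum U (X : {set I} -> U) : local (enum I) X.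
Proof.
by move=> W W' WW; congr X; apply/setP => i; apply: WW; rewrite mem_enum.
Qed.

Lemma local_nil U (X : {set I} -> U) W : local [::] X -> X W = X set0.
Proof. exact. Qed.

(** By induction on the coordinates of [X]: fixing one of them leaves [Y] unchanged. *)
Lemma expect_indep f s X Y : local s X ->
  (forall W W', (forall i, i \notin s -> (i \in W) = (i \in W')) -> Y W = Y W') ->
  expect f (fun W => X W * Y W) = expect f X * expect f Y.
Proof.
elim: s X => [|j s IHs] X Xl Yl.
  have XE W : X W = X set0 by apply: local_nil.
  rewrite (@eq_expect f _ (fun W => X set0 * Y W)) => [|W]; last by rewrite XE.
  by rewrite expectZ (expect_cst f XE).
have Yl' W W' : (forall i, i \notin s -> (i \in W) = (i \in W')) -> Y W = Y W'.
  by move=> WW; apply: Yl => i; rewrite inE negb_or => /andP[_ /WW].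
have YD W : Y (W :\ j) = Y W.
  by apply: Yl => i; rewrite !inE negb_or => /andP[-> _].
have YU W : Y (j |: W) = Y W.
  by apply: Yl => i; rewrite !inE negb_or => /andP[/negPf-> _].
rewrite (expect_step f j) (expect_step f j X).
under eq_expect do rewrite YD.
under [X in _ + f j * X]eq_expect do rewrite YU.
rewrite (IHs (fun W => X (W :\ j))) // ?(IHs (fun W => X (j |: W))) //.
- by ring.
- exact: local_add.
- exact: local_del.
Qed.

Definition decreasing (X : {set I} -> R) :=
  forall W W' : {set I}, W \subset W' -> X W' <= X W.

(** On one coordinate of parameter [t] this is Chebyshev's inequality for two
    decreasing pairs of numbers, with the nonnegative excess
    [t * (1 - t) * (x0 - x1) * (y0 - y1)]; induction on the coordinates does the rest. *)
Lemma harris f X Y : (forall i, 0 <= f i <= 1) ->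
  decreasing X -> decreasing Y ->
  expect f X * expect f Y <= expect f (fun W => X W * Y W).
Proof.
move=> f01; move: (local_enum X) (local_enum Y).
elim: (enum I) X Y => [|j s IHs] X Y Xl Yl Xd Yd.
  have XE W : X W = X set0 by apply: local_nil.
  have YE W : Y W = Y set0 by apply: local_nil.
  rewrite (expect_cst f XE) (expect_cst f YE) (@expect_cst _ _ (X set0 * Y set0)) //.
  by move=> W; rewrite XE YE.
have dD (Z : {set I} -> R) : decreasing Z -> decreasing (fun W => Z (W :\ j)).
  by move=> Zd W W' WW; apply/Zd/setSD.
have dU (Z : {set I} -> R) : decreasing Z -> decreasing (fun W => Z (j |: W)).
  by move=> Zd W W' WW; apply/Zd/setUS.
have DU (Z : {set I} -> R) : decreasing Z ->
    expect f (fun W => Z (j |: W)) <= expect f (fun W => Z (W :\ j)).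
  by move=> Zd; apply: expect_le => // W; apply/Zd/subsetP => i; rewrite !inE => /andP[_ ->]; rewrite orbT.
have := IHs _ _ (local_del Xl) (local_del Yl) (dD _ Xd) (dD _ Yd).
have := IHs _ _ (local_add Xl) (local_add Yl) (dU _ Xd) (dU _ Yd).
have := DU X Xd; have := DU Y Yd.
rewrite (expect_step f j X) (expect_step f j Y) (expect_step f j (fun W => X W * Y W)).
move: (expect f _) (expect f _) (expect f _) (expect f _) (expect f _) (expect f _).
move=> x0 x1 y1 y0 z1 z0.
have /andP[] := f01 j; move: (f j) => t t0 t1 xx yy H1 H0.
have t1' : 0 <= 1 - t by lra.
have : 0 <= (t * (1 - t)) * ((z1 - z0) * (y1 - y0)).
  by rewrite !mulr_ge0 //; lra.
have := ler_wpM2l t0 H1; have := ler_wpM2l t1' H0.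
by lra.
Qed.

Definition increasing A := forall W W' : {set I}, W \subset W' -> A W -> A W'.

(** Disjoint occurrence. When the second event is increasing, it may as well use
    all that the witness of the first one leaves over. *)
Definition disj A A' : pred {set I} :=
  fun W => [exists W1 : {set I}, [&& W1 \subset W, A W1 & A' (W :\: W1)]].

Lemma disj_increasing A A' : increasing A' -> increasing (disj A A').
Proof.
move=> A'i W W' WW /existsP[W1 /and3P[W1W AW AW']]; apply/existsP; exists W1.
rewrite (subset_trans W1W WW) AW /=; apply: A'i AW'; exact: setSD.
Qed.

(** The van den Berg-Kesten inequality for increasing events. Split according to
    one coordinate [j]: when it is absent, both events occur disjointly without
    it; when it is present, it serves one of the two witnesses. The second case
    is bounded in two ways, by inclusion-exclusion and by letting both events use
    [j]; averaging the two bounds with weights [1 - t] and [t] gives exactly the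
    expansion of the product. *)
Lemma bk f A A' : (forall i, 0 <= f i <= 1) -> increasing A -> increasing A' ->
  prob f (disj A A') <= prob f A * prob f A'.
Proof.
move=> f01; move: (local_enum A) (local_enum A').
elim: (enum I) A A' => [|j s IHs] A A' Al A'l Ai A'i.
  have AE W : A W = A set0 by apply: local_nil.
  have A'E W : A' W = A' set0 by apply: local_nil.
  have -> : prob f A = (A set0)%:R by apply: expect_cst => W; rewrite AE.
  have -> : prob f A' = (A' set0)%:R by apply: expect_cst => W; rewrite A'E.
  rewrite -[leRHS](expect_const f).
  apply: expect_le => // W; rewrite -natrM ler_nat mulnb.
  case E: (disj _ _ _) => //; case/existsP: E => W1 /and3P[_].
  by rewrite AE A'E => -> ->.
pose D A W := A (W :\ j); pose U A W := A (j |: W).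
have iD B : increasing B -> increasing (D B).
  by move=> Bi W W' WW; apply/Bi/setSD.
have iU B : increasing B -> increasing (U B).
  by move=> Bi W W' WW; apply/Bi/setUS.
have DU B W : increasing B -> D B W -> U B W.
  by move=> Bi; apply/Bi/subsetP => i; rewrite !inE => /andP[_ ->]; rewrite orbT.
have disj_mono (B1 B2 B1' B2' : pred {set I}) W : (forall W, B1 W -> B1' W) -> (forall W, B2 W -> B2' W) ->
    disj B1 B2 W -> disj B1' B2' W.
  move=> H1 H2 /existsP[W1 /and3P[W1W /H1 h1 /H2 h2]].
  by apply/existsP; exists W1; rewrite W1W h1.
have IH00 := IHs _ _ (local_del Al) (local_del A'l) (iD _ Ai) (iD _ A'i).
have IH01 := IHs _ _ (local_del Al) (local_add A'l) (iD _ Ai) (iU _ A'i).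
have IH10 := IHs _ _ (local_add Al) (local_del A'l) (iU _ Ai) (iD _ A'i).
have IH11 := IHs _ _ (local_add Al) (local_add A'l) (iU _ Ai) (iU _ A'i).
have z0 : prob f (D (disj A A')) <= prob f (disj (D A) (D A')).
  apply: prob_le => // W /existsP[W1 /and3P[W1W AW AW']]; apply/existsP; exists W1.
  have jW1 : W1 :\ j = W1.
    apply/setDidPl; rewrite disjoint_sym disjoints1; apply/negP => /(subsetP W1W).
    by rewrite !inE eqxx.
  rewrite /D jW1 AW (subset_trans W1W (subD1set _ _)) /=.
  by apply: A'i AW'; apply/subsetP => i; rewrite !inE => /and3P[-> -> ->].
have zU W : U (disj A A') W -> disj (U A) (D A') W || disj (D A) (U A') W.
  case/existsP=> W1 /and3P[W1W AW AW']; apply/orP; case: (boolP (j \in W1)) => jW1; [left|right].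
    apply/existsP; exists (W1 :\ j); apply/and3P; split.
    - apply/subsetP => i; rewrite !inE => /andP[/negPf ij /(subsetP W1W)].
      by rewrite !inE ij.
    - by rewrite /U setD1K.
    apply: A'i AW'; apply/subsetP => i; rewrite !inE => /andP[iW1].
    by case: eqP iW1 => [->|]; rewrite ?jW1 //= => _ -> ->.
  have W1j : W1 :\ j = W1 by apply/setDidPl; rewrite disjoint_sym disjoints1.
  apply/existsP; exists W1; apply/and3P; split.
  - apply/subsetP => i iW1; have := subsetP W1W _ iW1; rewrite !inE.
    by case: eqP iW1 jW1 => //= -> ->.
  - by rewrite /D W1j.
  apply: A'i AW'; apply/subsetP => i; rewrite !inE.
  by case: eqP => //= _ /andP[-> ->].
have z1 : prob f (U (disj A A')) <= prob f (disj (U A) (U A')).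
  apply: prob_le => // W /zU/orP[]; apply: disj_mono => // W'; exact: DU.
have z2 : prob f (U (disj A A')) <= prob f (disj (U A) (D A'))
     + prob f (disj (D A) (U A')) - prob f (disj (D A) (D A')).
  rewrite -expectD -expectB; apply: expect_le => // W.
  have := zU W.
  have : disj (D A) (D A') W -> disj (U A) (D A') W && disj (D A) (U A') W.
    move=> H; apply/andP; split; apply: disj_mono H => // W'; exact: DU.
  case: (disj (D A) (D A') W); case: (disj (U A) (D A') W);
  case: (disj (D A) (U A') W); case: (U _ W) => /= H1 H2;
    by [lra | have := H1 isT | have := H2 isT].
have stp B : prob f B = (1 - f j) * prob f (D B) + f j * prob f (U B).
  exact: expect_step.
rewrite (stp A) (stp A') stp.
move: (prob f (D (disj _ _))) (prob f (U (disj _ _))) z0 z1 z2 IH00 IH01 IH10 IH11.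
move: (prob f (disj (D A) (D A'))) (prob f (disj (D A) (U A'))).
move: (prob f (disj (U A) (D A'))) (prob f (disj (U A) (U A'))).
move: (prob f (D A)) (prob f (U A)) (prob f (D A')) (prob f (U A')).
have /andP[] := f01 j; move: (f j) => t t0 t1.
move=> a0 a1 b0 b1 e10 e11 e01 e00 z0 z1 h0 h1 h2 h00 h01 h10 h11.
have t1' : 0 <= 1 - t by lra.
have := ler_wpM2l t1' h0; have := ler_wpM2l t0 (ler_wpM2l t1' h2).
have := ler_wpM2l t0 (ler_wpM2l t0 h1); have := ler_wpM2l t0 (ler_wpM2l t0 h11).
have := ler_wpM2l t0 (ler_wpM2l t1' h01); have := ler_wpM2l t0 (ler_wpM2l t1' h10).
have := ler_wpM2l t1' (ler_wpM2l t1' h00).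
by lra.
Qed.

(** Lets a configuration at a larger parameter be built by sprinkling. *)
Lemma expect_layers f1 f2 X :
  expect f1 (fun W1 => expect f2 (fun W2 => X (W1 :|: W2))) =
  expect (fun i => 1 - (1 - f1 i) * (1 - f2 i)) X.
Proof.
move: (local_enum X); elim: (enum I) X => [|j s IHs] X Xl.
  have XE W : X W = X set0 by apply: local_nil.
  rewrite (expect_cst _ XE); apply: expect_cst => W1; apply: expect_cst => W2.
  exact: XE.
rewrite (expect_step f1 j) (expect_step _ j X).
have -> : expect f1 (fun W1 => expect f2 (fun W2 => X (W1 :\ j :|: W2))) =
    (1 - f2 j) * expect f1 (fun W1 => expect f2 (fun W2 => X ((W1 :|: W2) :\ j)))
    + f2 j * expect f1 (fun W1 => expect f2 (fun W2 => X (j |: (W1 :|: W2)))).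
  rewrite -!expectZ -expectD; apply: eq_expect => W1; rewrite (expect_step f2 j).
  congr (_ * _ + _ * _); apply: eq_expect => W2; congr X; apply/setP => i; rewrite !inE.
    by case: (i == j).
  by case: (i == j).
have -> : expect f1 (fun W1 => expect f2 (fun W2 => X (j |: W1 :|: W2))) =
    expect f1 (fun W1 => expect f2 (fun W2 => X (j |: (W1 :|: W2)))).
  by apply: eq_expect => W1; apply: eq_expect => W2; rewrite setUA.
rewrite (IHs (fun W => X (W :\ j)) (local_del Xl)).
rewrite (IHs (fun W => X (j |: W)) (local_add Xl)).
by ring.
Qed.

Lemma expect_restrict f (K : {set I}) X :
  expect f (fun W => X (W :&: K)) = expect (fun i => if i \in K then f i else 0) X.
Proof.
move: (local_enum X); elim: (enum I) X => [|j s IHs] X Xl.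
  have XE W : X W = X set0 by apply: local_nil.
  by rewrite (expect_cst _ XE); apply: expect_cst => W.
rewrite (expect_step f j) (expect_step _ j X).
rewrite -(IHs (fun W => X (W :\ j)) (local_del Xl)).
rewrite -(IHs (fun W => X (j |: W)) (local_add Xl)).
have -> : expect f (fun W => X ((W :\ j) :&: K)) = expect f (fun W => X ((W :&: K) :\ j)).
  by apply: eq_expect => W; rewrite setIDAC.
case: ifP => jK.
  congr (_ + _ * _); apply: eq_expect => W; congr X; apply/setP => i; rewrite !inE.
  by case: eqP => // ->; rewrite jK.
have -> : expect f (fun W => X ((j |: W) :&: K)) = expect f (fun W => X ((W :&: K) :\ j)).
  apply: eq_expect => W; congr X; apply/setP => i; rewrite !inE.
  by case: eqP => // ->; rewrite jK.
by ring.
Qed.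

Lemma expect_supp f X Y : (forall W, (forall i, i \in W -> f i != 0) -> X W = Y W) ->
  expect f X = expect f Y.
Proof.
move=> XY; apply: eq_bigr => W _.
case: (boolP [forall i in W, f i != 0]) => [/forall_inP|]; first by move/XY->.
rewrite negb_forall_in => /exists_inP[i iW]; rewrite negbK => /eqP fi0.
by rewrite /wt (bigD1 i) //= iW fi0 !mul0r.
Qed.

Lemma expect_inj f (h : I -> I) X : injective h -> (forall i, f (h i) = f i) ->
  expect f X = expect f (fun W => X (h @: W)).
Proof.
move=> h_inj fh.
have himj : injective (fun W : {set I} => h @: W).
  exact: imset_inj.
rewrite /expect (reindex_inj himj); apply: eq_bigr => W _; congr (_ * _).
rewrite /wt (reindex_inj h_inj); apply: eq_bigr => i _.
by rewrite fh (mem_imset W i h_inj).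
Qed.

End ProductMeasure.

(** * Connectivity, disjoint connections and forks *)

Section Connectivity.
Local Open Scope nat_scope.
Variable T : finType.
Implicit Types (W F : {set {set T}}) (D S b : {set T}) (x y z u v : T).


Lemma adj_sym W : symmetric (adj W).
Proof. by move=> x y; rewrite /adj setUC. Qed.

Lemma conn_sym W x y : conn W x y = conn W y x.
Proof. exact/sym_connect_sym/adj_sym. Qed.

Lemma conn_sub W W' x y : W \subset W' -> conn W x y -> conn W' x y.
Proof.
move=> WW; apply: connect_sub => u v uv; apply: connect1; exact: subsetP WW _ uv.
Qed.

Lemma conn_closed W S x y : (forall u v, u \in S -> adj W u v -> v \in S) ->
  x \in S -> conn W x y -> y \in S.
Proof.
move=> Scl xS /connectP[p]; elim: p x xS => [|z p IHp] x xS /= => [_ ->//|].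
by case/andP=> /(Scl _ _ xS) zS; apply: IHp.
Qed.

Lemma conn_transfer W W' x y :
  (forall u v, conn W x u -> adj W u v -> adj W' u v) ->
  conn W x y -> conn W' x y.
Proof.
move=> WW' xy.
suff /(_ y xy) : forall z, conn W x z -> z \in cluster W x :&: cluster W' x.
  by rewrite !inE => /andP[].
move=> z; apply: conn_closed; last by rewrite !inE !connect0.
move=> u v; rewrite !inE => /andP[xu xu'] uv; apply/andP; split.
  by apply: connect_trans xu (connect1 uv).
by apply: connect_trans xu' (connect1 _); apply: WW'.
Qed.

Lemma mem_cluster W x y : (y \in cluster W x) = conn W x y.
Proof. by rewrite inE. Qed.

Lemma cluster_sub W W' x : W \subset W' -> cluster W x \subset cluster W' x.
Proof. by move=> WW; apply/subsetP => y; rewrite !inE; apply: conn_sub. Qed.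

Lemma cluster_refl W x : x \in cluster W x.
Proof. by rewrite inE connect0. Qed.

(** A vertex is green when its singleton belongs to the configuration, so that
    bonds and green vertices live in one and the same product space; a singleton
    only adds a loop to the graph. *)
Definition green W x : bool := [exists z, conn W x z && ([set z] \in W)].

Lemma greenP W x : reflect (exists2 z, conn W x z & [set z] \in W) (green W x).
Proof.
by apply: (iffP existsP) => [[z /andP[]]|[z xz zW]]; exists z => //; rewrite xz.
Qed.

Lemma green_sub W W' x : W \subset W' -> green W x -> green W' x.
Proof.
move=> WW /greenP[z xz zW]; apply/greenP; exists z; first exact: conn_sub xz.
exact: subsetP WW _ zW.
Qed.

Lemma green_conn W x y : conn W x y -> green W x = green W y.
Proof.
by move=> xy; apply/greenP/greenP => -[z xz zW]; exists z => //;
  apply: connect_trans xz; rewrite // conn_sym.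
Qed.

Lemma increasing_conn x y : increasing (fun W => conn W x y).
Proof. by move=> W W' WW; apply: conn_sub. Qed.

Lemma increasing_green x : increasing (fun W => green W x).
Proof. by move=> W W' WW; apply: green_sub. Qed.

(** [F] is the set of bonds of a self-avoiding path from [x] to [z] and [S] its set
    of vertices; the path can be cut at each of them. *)
Lemma path_split W x z : conn W x z -> exists F : {set {set T}}, exists S,
  [/\ F \subset W, forall b, b \in F -> #|b| = 2 /\ b \subset S,
      x \in S, z \in S & forall w, w \in S -> exists F1 : {set {set T}},
        [/\ F1 \subset F, conn F1 x w & conn (F :\: F1) w z]].
Proof.
case/connectP=> p0 /shortenP[p xp Up _] {p0} zE.
suff [F [FW Fb FS]] : exists F : {set {set T}},
  [/\ F \subset W, forall b, b \in F -> #|b| = 2 /\ b \subset [set y in x :: p]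
    & forall w, w \in x :: p -> exists F1 : {set {set T}},
        [/\ F1 \subset F, conn F1 x w & conn (F :\: F1) w (last x p)]].
  exists F, [set y in x :: p]; split=> //.
  - by rewrite inE mem_head.
  - by rewrite inE zE mem_last.
  by move=> w; rewrite inE => /FS; rewrite zE.
elim: p x xp Up {zE} => [|y p IHp] x /=.
  move=> _ _; exists set0; split; [exact: sub0set | by move=> b; rewrite inE |].
  move=> w; rewrite inE => /eqP->; exists set0; split; [exact: sub0set | |];
    exact: connect0.
case/andP=> xy yp /andP[xNp Up].
have [F [FW Fb FS]] := IHp y yp Up.
have xy_neq : x != y by apply: contraNneq xNp => ->; rewrite mem_head.
have eNF : [set x; y] \notin F.
  apply: contra xNp => /Fb[_ /subsetP/(_ x)]; rewrite !inE eqxx => /(_ isT).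
  by [].
exists ([set x; y] |: F); split.
- by rewrite subUset sub1set FW andbT.
- move=> b; rewrite in_setU1 => /predU1P[->|/Fb[-> /subsetP bS]].
    rewrite cards2 xy_neq; split=> //; apply/subsetP => u; rewrite !inE.
    by case/orP=> ->; rewrite ?orbT.
  split=> //; apply/subsetP => u /bS; rewrite !inE => /orP[]->; by rewrite !orbT.
have adjxy (G : {set {set T}}) : [set x; y] \in G -> conn G x y by move=> ?; apply: connect1.
move=> w; rewrite inE => /predU1P[->|wp].
  have [F1 [_ _ _]] := FS y (mem_head _ _).
  exists set0; rewrite sub0set setD0 connect0; split=> //.
  apply: connect_trans (adjxy _ (setU11 _ _)) _.
  have [F2 [F2F yw wz]] := FS y (mem_head _ _).
  by apply: conn_sub wz; apply: subset_trans (subsetDl _ _) (subsetUr _ _).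
have [F1 [F1F yw wz]] := FS w wp.
exists ([set x; y] |: F1); split.
- exact: setUS.
- apply: connect_trans (adjxy _ (setU11 _ _)) _.
  apply: conn_sub yw; exact: subsetUr.
- apply: conn_sub wz; apply/subsetP => b; rewrite !inE => /andP[bF1 bF].
  rewrite bF orbT andbT negb_or bF1 andbT.
  by apply: contraNneq eNF => <-.
Qed.

Lemma conn_first_hit W F S g x : (forall b, b \in F -> b \subset S) ->
  x \in S -> conn W g x -> exists2 w, w \in S & conn (W :\: F) g w.
Proof.
move=> FS xS /connectP[p]; elim: p g => [|h p IHp] g /=.
  by move=> _ xE; exists x => //; rewrite xE connect0.
case/andP=> gh hp xE; case: (boolP (g \in S)) => gS; first by exists g.
have [w wS hw] := IHp h hp xE; exists w => //; apply: connect_trans hw.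
apply: connect1; rewrite /adj inE [_ \in W]gh andbT.
by apply: contra gS => /FS/subsetP; apply; rewrite !inE eqxx.
Qed.

(** The self-avoiding path from [x] to [z] meets a path from the green vertex at a
    first point [w], which is where the three disjoint connections meet. *)
Lemma tripod W x z : conn W x z -> green W x ->
  exists w, disj (fun W => conn W x w)
    (disj (fun W => conn W w z) (fun W => green W w)) W.
Proof.
move=> xz /greenP[g xg gW].
have [F [S [FW Fb xS zS FS]]] := path_split xz.
rewrite conn_sym in xg.
have [w wS gw] := conn_first_hit (fun b bF => (Fb b bF).2) xS xg.
have [F1 [F1F xw wz]] := FS w wS.
exists w; apply/existsP; exists F1; rewrite (subset_trans F1F FW) xw /=.
apply/existsP; exists (F :\: F1); rewrite setSD // wz /=.
apply: (@green_sub (W :\: F)).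
  apply/subsetP => b; rewrite !inE => /andP[bF ->].
  by rewrite (negPf bF) andbF /= andbT; apply: contra bF => /(subsetP F1F).
apply/greenP; exists g; first by rewrite conn_sym.
by rewrite inE gW andbT; apply/negP => /Fb[]; rewrite cards1.
Qed.

Definition touch D : {set {set T}} := [set b | b :&: D != set0].

Definition off D W : {set {set T}} := W :\: touch D.

Lemma off_sub D W : off D W \subset W.
Proof. exact: subsetDl. Qed.

Lemma mem_touch D b x : x \in b -> x \in D -> b \in touch D.
Proof. by move=> xb xD; rewrite inE; apply/set0Pn; exists x; rewrite inE xb. Qed.

Lemma notin_touch D b : (b \notin touch D) = (b \subset ~: D).
Proof. by rewrite inE negbK setI_eq0 disjoints_subset. Qed.

(** A self-avoiding path to a green vertex that is lost off [D] visits [D], and is cut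
    there. *)
Lemma green_through W D v : green W v -> ~~ green (off D W) v ->
  exists2 z, z \in D & disj (fun W => conn W v z) (fun W => green W z) W.
Proof.
case/greenP=> g vg gW offN.
have [F [S [FW Fb vS gS FS]]] := path_split vg.
case: (set_0Vmem (S :&: D)) => [SD0|[z]].
  have SD y : y \in S -> y \notin D.
    by move=> yS; apply/negP => yD; have := in_set0 y; rewrite -SD0 inE yS yD.
  case/negP: offN; apply/greenP; have [F1 [F1F vg1 _]] := FS g gS.
  exists g; last first.
    by rewrite inE gW andbT notin_touch sub1set inE SD.
  apply: conn_sub vg1; apply/subsetP => b /(subsetP F1F) bF.
  rewrite inE (subsetP FW) // andbT notin_touch; apply/subsetP => y yb.
  by rewrite inE; apply/SD/(subsetP (Fb b bF).2).
rewrite inE => /andP[zS zD]; exists z => //.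
have [F1 [F1F vz zg]] := FS z zS.
apply/existsP; exists F1; rewrite (subset_trans F1F FW) vz /=.
apply/greenP; exists g; first by apply: conn_sub zg; apply: setSD.
by rewrite inE gW andbT; apply/negP => /(subsetP F1F)/Fb[]; rewrite cards1.
Qed.

(** The part of the graph revealed by exploring the clusters of [S]. *)
Definition reach S W : {set T} := [set y | [exists x in S, conn W x y]].

Lemma reachP S W y : reflect (exists2 x, x \in S & conn W x y) (y \in reach S W).
Proof. by rewrite inE; apply: exists_inP. Qed.

Lemma reach1 x W : reach [set x] W = cluster W x.
Proof.
apply/setP => y; rewrite [in RHS]inE; apply/reachP/idP => [[z]|xy].
  by rewrite inE => /eqP->.
by exists x; rewrite ?inE.
Qed.

Lemma reach2 x v W : reach [set x; v] W = cluster W x :|: cluster W v.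
Proof.
apply/setP => y; rewrite [in RHS]inE !mem_cluster; apply/reachP/orP => [[z]|].
  by rewrite !inE => /orP[]/eqP->; [left|right].
by case=> zy; [exists x | exists v]; rewrite ?inE ?eqxx ?orbT.
Qed.

Lemma reach_closed S W u v : u \in reach S W -> adj W u v -> v \in reach S W.
Proof.
case/reachP=> x xS xu uv; apply/reachP; exists x => //.
exact: connect_trans xu (connect1 uv).
Qed.

Lemma conn_off S W u v : u \notin reach S W ->
  conn (off (reach S W) W) u v = conn W u v.
Proof.
move=> uS; apply/idP/idP; first by apply/conn_sub/off_sub.
apply: conn_transfer => y z uy yz; rewrite /adj inE [_ \in W]yz andbT.
have yS : y \notin reach S W.
  apply: contra uS => yS; apply: (conn_closed _ yS); first exact: (@reach_closed S W).
  by rewrite conn_sym.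
rewrite notin_touch; apply/subsetP => t; rewrite in_set2 in_setC => /orP[]/eqP-> //.
by apply: contra yS => zS; apply: reach_closed zS _; rewrite adj_sym.
Qed.

Lemma green_off S W v : green (off (reach S W) W) v = (v \notin reach S W) && green W v.
Proof.
case: (boolP (v \in reach S W)) => vS /=.
  apply/negbTE/negP => /greenP[z vz]; rewrite inE notin_touch sub1set inE => /andP[/negP zS _].
  apply: zS; apply: (conn_closed _ vS); first exact: (@reach_closed S W).
  by apply: conn_sub vz; apply: off_sub.
apply/idP/idP; first by apply/green_sub/off_sub.
case/greenP=> z vz zW; apply/greenP; exists z; first by rewrite conn_off.
rewrite inE zW andbT notin_touch sub1set inE; apply: contra vS => zS.
apply: (conn_closed _ zS); first exact: (@reach_closed S W).
by rewrite conn_sym.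
Qed.

Lemma conn_local S W W' x y : x \in S ->
  (forall b, b \in touch (reach S W) -> (b \in W) = (b \in W')) ->
  conn W x y = conn W' x y.
Proof.
move=> xS WW.
have xy u v : conn W x u -> (adj W u v = adj W' u v).
  move=> xu; apply: WW; apply: (@mem_touch _ _ u); first by rewrite !inE eqxx.
  by apply/reachP; exists x.
apply/idP/idP; first by apply: conn_transfer => u v /xy<-.
move=> xy'; rewrite -mem_cluster; move: xy'; apply: conn_closed.
  move=> u v; rewrite !mem_cluster => xu; rewrite -xy // => uv.
  exact: connect_trans xu (connect1 uv).
exact: cluster_refl.
Qed.

Lemma reach_local S W W' :
  (forall b, b \in touch (reach S W) -> (b \in W) = (b \in W')) ->
  reach S W = reach S W'.
Proof.
move=> WW; apply/setP => y; apply/reachP/reachP => -[x xS xy]; exists x => //.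
  by rewrite -(conn_local _ xS WW).
by rewrite (conn_local _ xS WW).
Qed.

Lemma green_local S W W' x : x \in S ->
  (forall b, b \in touch (reach S W) -> (b \in W) = (b \in W')) ->
  green W x = green W' x.
Proof.
move=> xS WW; apply: eq_existsb => z; rewrite -(conn_local _ xS WW).
case xz: (conn W x z) => //=; apply: WW; apply: (@mem_touch _ _ z); first by rewrite inE.
by apply/reachP; exists x.
Qed.

Lemma cluster_inside W u :
  cluster [set b in W | b \subset cluster W u] u = cluster W u.
Proof.
apply/eqP; rewrite eqEsubset cluster_sub /=; last by apply/subsetP => b; rewrite inE => /andP[].
apply/subsetP => y; rewrite !mem_cluster; apply: conn_transfer => s t us st.
rewrite /adj inE [_ \in W]st; apply/subsetP => r; rewrite !inE => /orP[]/eqP-> //.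
exact: connect_trans us (connect1 st).
Qed.

Lemma conn_outside W S u y : [disjoint cluster W u & S] ->
  conn W u y -> conn (W :\: [set b in W | b \subset S]) u y.
Proof.
move=> dis; apply: conn_transfer => s t us st.
rewrite /adj inE [_ \in W]st andbT inE [_ \in W]st /=; apply/negP => /subsetP/(_ s).
rewrite !inE eqxx => /(_ isT) sS; have := disjointFr dis; move=> /(_ s).
by rewrite mem_cluster us sS => /(_ isT).
Qed.

Lemma cluster_del W u v y : conn W u y ->
  y \in cluster (W :\ [set u; v]) u :|: cluster (W :\ [set u; v]) v.
Proof.
apply: conn_closed; last by rewrite !inE connect0.
move=> s t sS st; case: (eqVneq [set s; t] [set u; v]) => [E|NE].
  have : t \in [set u; v] by rewrite -E !inE eqxx orbT.
  by rewrite !inE => /orP[]/eqP->; rewrite connect0 ?orbT.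
have st' : conn (W :\ [set u; v]) s t by apply: connect1; rewrite /adj !inE NE.
move: sS; rewrite !inE => /orP[]us; apply/orP; [left|right]; exact: connect_trans us st'.
Qed.

(** Splitting a cluster into two disjoint connected pieces of prescribed sizes.
    Among the pieces [F] of [W] hanging at a vertex [u] of what remains, with at
    least [b] vertices, a minimal one has fewer than [2 * b] vertices.
    Otherwise remove a bond of [F] at [u]: either what remains of [F] is still
    such a piece, or it falls into two parts and one of them is. *)
Lemma cluster_disj W x (a b : nat) : a + b.*2 <= #|cluster W x| ->
  disj (fun W => a <= #|cluster W x|) (fun W => b <= Cmax W) W.
Proof.
move=> leab; case: (posnP b) => [b0|b_gt0].
  apply/existsP; exists W; rewrite subxx /=; apply/andP; split; lia.
pose hang u F := [&& u \in cluster (W :\: F) x,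
  cluster W x \subset cluster (W :\: F) x :|: cluster F u & b <= #|cluster F u|].
pose P F := (F \subset W) && [exists u, hang u F].
have [F /minsetP[/andP[FW /existsP[u /and3P[ux cov bF]]] Fmin]] : {F | minset P F}.
  apply: ex_minset; exists W; rewrite /P subxx; apply/existsP; exists x.
  rewrite /hang cluster_refl subsetUr /=; lia.
have Fproper (G : {set {set T}}) v : G \subset F -> hang v G -> G = F.
  move=> GF hG; apply: Fmin => //; rewrite /P (subset_trans GF FW).
  by apply/existsP; exists v.
have small : #|cluster F u| < b.*2.
  rewrite ltnNge; apply/negP => big.
  have [y uy yNu] : exists2 y, conn F u y & y != u.
    have : 0 < #|cluster F u :\ u| by have := cardsD1 u (cluster F u); rewrite cluster_refl; lia.
    by case/card_gt0P=> y; rewrite !inE => /andP[yu uy]; exists y.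
  have [v uv] : exists v, adj F u v.
    case/connectP: uy => -[|v p] /=; first by move=> _ yE; rewrite yE eqxx in yNu.
    by case/andP=> uv _ _; exists v.
  pose F' := F :\ [set u; v].
  have F'F : F' \subset F by apply: subD1set.
  have eF' : [set u; v] \notin F' by rewrite !inE eqxx.
  have Fne (G : {set {set T}}) : G \subset F' -> G <> F.
    by move=> GF' GF; case/negP: eF'; apply: (subsetP GF'); rewrite GF.
  have covF z : conn W x z -> [|| conn (W :\: F) x z, conn F' u z | conn F' v z].
    move=> xz; have := subsetP cov z; rewrite !inE => /(_ xz)/orP[->//|].
    by move/(cluster_del v); rewrite !inE => ->; rewrite orbT.
  case: (boolP (conn F' u v)) => uv'.
    apply: (Fne F' (subxx _)); apply: (@Fproper _ u) => //; apply/and3P; split.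
    - by apply: (subsetP (cluster_sub _ (setDS W F'F))).
    - apply/subsetP => z; rewrite !inE => /covF/or3P[xz|->|vz]; rewrite ?orbT //.
        by rewrite (conn_sub (setDS W F'F) xz).
      by rewrite (connect_trans uv' vz) orbT.
    apply: leq_trans bF (subset_leq_card _); apply/subsetP => z; rewrite !inE.
    move/(cluster_del v); rewrite !inE => /orP[->//|]; exact: connect_trans uv'.
  have dis : [disjoint cluster F' u & cluster F' v].
    rewrite disjoints_subset; apply/subsetP => z; rewrite !inE => uz.
    by apply: contra uv' => vz; apply: connect_trans uz _; rewrite conn_sym.
  have key s t : [disjoint cluster F' s & cluster F' t] -> [set s; t] = [set u; v] ->
      b <= #|cluster F' s| -> False.
    move=> st_dis stE bs.
    pose G := [set c in F' | c \subset cluster F' s].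
    have GF' : G \subset F' by apply/subsetP => c; rewrite inE => /andP[].
    have GF := subset_trans GF' F'F.
    have eG : [set s; t] \in W :\: G.
      rewrite stE inE (subsetP FW _ uv) andbT; apply: contra eF'; exact: subsetP.
    have est : conn (W :\: G) s t by apply: connect1.
    have ux' : conn (W :\: G) x u.
      by rewrite mem_cluster in ux; apply: conn_sub ux; apply: setDS.
    have stx : conn (W :\: G) x s && conn (W :\: G) x t.
      have : u \in [set s; t] by rewrite stE !inE eqxx.
      rewrite !inE => /orP[]/eqP uE; move: ux'; rewrite uE => xs.
        by rewrite xs (connect_trans xs est).
      by rewrite xs andbT; apply: connect_trans xs _; rewrite conn_sym.
    have/andP[xs xt] := stx.
    have GE : cluster G s = cluster F' s by apply: cluster_inside.
    apply: (Fne G GF'); apply: (@Fproper _ s) => //; apply/and3P; split.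
    - by rewrite mem_cluster.
    - apply/subsetP => z; rewrite [z \in cluster W x]inE => /covF H.
      have : [|| conn (W :\: F) x z, conn F' s z | conn F' t z].
        have : ((s == u) && (t == v)) || ((s == v) && (t == u)).
          have : u \in [set s; t] by rewrite stE !inE eqxx.
          have : v \in [set s; t] by rewrite stE !inE eqxx orbT.
          have : s \in [set u; v] by rewrite -stE !inE eqxx.
          have : t \in [set u; v] by rewrite -stE !inE eqxx orbT.
          by rewrite !inE ![u == _]eq_sym ![v == _]eq_sym;
            case: (s == u); case: (s == v); case: (t == u); case: (t == v).
        case/orP=> /andP[/eqP-> /eqP->] //.
        by case/or3P: H => ->; rewrite ?orbT.
      rewrite in_setU GE !mem_cluster => /or3P[xz|->|tz]; rewrite ?orbT //.
        by rewrite (conn_sub (setDS W GF) xz).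
      suff -> : conn (W :\: G) x z by [].
      apply: connect_trans xt _.
      rewrite disjoint_sym in st_dis.
      have := conn_outside st_dis tz; apply: conn_sub; apply: setSD.
      exact: subset_trans F'F FW.
    - by rewrite GE.
  have : #|cluster F u| <= #|cluster F' u| + #|cluster F' v|.
    apply: leq_trans (leq_card_setU _ _); apply: subset_leq_card.
    by apply/subsetP => z; rewrite [z \in cluster F u]inE; apply: cluster_del.
  move=> sum; have [bu|bu] := leqP b #|cluster F' u|; first exact: (key u v).
  by apply: (key v u); [rewrite disjoint_sym | exact: setUC | lia].
apply/existsP; exists (W :\: F); rewrite subsetDl /=; apply/andP; split.
  have := subset_leq_card cov; have := leq_card_setU (cluster (W :\: F) x) (cluster F u).
  by move=> /leqifP; case: ifP => _; lia.
have -> : W :\: (W :\: F) = F by rewrite setDDr setDv set0U; apply/setIidPr.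
apply: leq_trans bF _; exact: (leq_bigmax u).
Qed.

Definition fork W x u v1 v2 : bool :=
  [&& conn W x u, ~~ green W x, green W v1, green W v2 & ~~ conn W v1 v2].

(** The cluster of [x] would be green-free without the two occupied bonds from
    [u] to [v1] and to [v2], which lead to different green clusters. *)
Definition open_fork W x u v1 v2 : bool :=
  [&& [set u; v1] \in W, [set u; v2] \in W
    & fork (W :\: [set [set u; v1]; [set u; v2]]) x u v1 v2].

Lemma forkC W x u v1 v2 : fork W x u v1 v2 = fork W x u v2 v1.
Proof. by rewrite /fork (conn_sym W v1) [green W v1 && _]andbCA. Qed.

Lemma open_forkC W x u v1 v2 : open_fork W x u v1 v2 = open_fork W x u v2 v1.
Proof. by rewrite /open_fork forkC [X in _ :\: X]setUC andbCA. Qed.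

Lemma open_fork_green W x u v1 v2 : open_fork W x u v1 v2 -> green W x.
Proof.
case/and3P=> e1 _ /and5P[xu _ g1 _ _].
have WW : W :\: [set [set u; v1]; [set u; v2]] \subset W by apply: subsetDl.
rewrite (green_conn (connect_trans (conn_sub WW xu) (connect1 e1))).
exact: green_sub g1.
Qed.

Lemma fork_neq W x u v1 v2 : fork W x u v1 v2 -> [/\ u != v1, u != v2 & v1 != v2].
Proof.
case/and5P=> xu xg g1 g2 v12; rewrite (green_conn xu) in xg.
by split; [apply: contraNneq xg => -> | apply: contraNneq xg => ->
  | apply: contraNneq v12 => ->].
Qed.

Lemma avoid_conn W W0 (E : {set {set T}}) c s t : W0 \subset W ->
  (forall b, b \in E -> c \in b) -> ~~ conn W0 s c -> conn W0 s t -> conn (W :\: E) s t.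
Proof.
move=> W0W Ec sc; apply: conn_transfer => y z sy yz.
rewrite /adj inE (subsetP W0W _ yz) andbT; apply: contra sc => /Ec.
rewrite !inE => /orP[]/eqP-> //; exact: connect_trans sy (connect1 yz).
Qed.

Lemma avoid_green W W0 (E : {set {set T}}) c s : W0 \subset W ->
  (forall b, b \in E -> c \in b) -> ~~ conn W0 s c -> green W0 s -> green (W :\: E) s.
Proof.
move=> W0W Ec sc /greenP[z sz zW]; apply/greenP; exists z.
  exact: avoid_conn W0W Ec sc sz.
rewrite inE (subsetP W0W _ zW) andbT; apply: contra sc => /Ec.
by rewrite inE => /eqP->.
Qed.

(** Otherwise [u'] misses one of the two green clusters of the first fork, and
    [x] reaches that one without using any bond at [u']. *)
Lemma open_fork_root W x u v1 v2 u' v1' v2' :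
  open_fork W x u v1 v2 -> open_fork W x u' v1' v2' ->
  conn (W :\: [set [set u; v1]; [set u; v2]]) x u'.
Proof.
case/and3P=> e1 e2 Fk; have/and5P[xu xg g1 g2 v12] := Fk.
case/and3P=> e1' e2' Fk'; have/and5P[xu' xg' g1' g2' v12'] := Fk'.
apply/negPn/negP => xNu'.
set W0 := W :\: _ in xu xg g1 g2 v12 xNu'; set E := [set _; _] in xg'.
have W0W : W0 \subset W by apply: subsetDl.
have Eu' b : b \in E -> u' \in b by rewrite !inE => /orP[]/eqP->; rewrite !inE eqxx.
have no v : [set u; v] \in W -> green W0 v -> conn W0 v u'.
  move=> eW gv; apply/negPn/negP => vu'.
  case/negP: xg'; rewrite (green_conn (avoid_conn W0W Eu' xNu' xu)).
  rewrite (@green_conn _ u v); first exact: avoid_green W0W Eu' vu' gv.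
  apply: connect1; rewrite /adj inE eW andbT; apply/negP => /Eu'.
  rewrite !inE => /orP[]/eqP uE; first by case/negP: xNu'; rewrite uE.
  by case/negP: vu'; rewrite uE connect0.
case/negP: v12; apply: connect_trans (no _ e1 g1) _.
by rewrite conn_sym; apply: no.
Qed.

(** Otherwise [x] still reaches [u], then [v1] and its green cluster after the
    bonds of the second fork are removed. *)
Lemma open_fork_bond W x u v1 v2 u' v1' v2' :
  open_fork W x u v1 v2 -> open_fork W x u' v1' v2' ->
  [set u; v1] \in [set [set u'; v1']; [set u'; v2']].
Proof.
move=> of1 of2; have xu' := open_fork_root of1 of2; have xu := open_fork_root of2 of1.
case/and3P: of1 => e1 e2 /and5P[_ xg g1 _ _].
case/and3P: of2 => e1' e2' /and5P[_ xg' _ _ _].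
set W0 := W :\: _ in xg g1 xu'; set E := [set _; _] in xg' xu *.
apply/negPn/negP => eNE; case/negP: xg'; rewrite (green_conn xu).
rewrite (@green_conn _ u v1); last by apply: connect1; rewrite /adj inE eNE.
apply: (@avoid_green W W0 E u'); rewrite ?subsetDl //.
  by move=> b; rewrite !inE => /orP[]/eqP->; rewrite !inE eqxx.
apply: contra xg => v1u'; rewrite (green_conn xu').
by rewrite (green_conn v1u') in g1.
Qed.

(** The two bonds of an open fork are the only way from [x] to the green
    vertices, so they are determined by the configuration. *)
Lemma open_fork_unique W x u v1 v2 u' v1' v2' :
  open_fork W x u v1 v2 -> open_fork W x u' v1' v2' ->
  (u', v1', v2') = (u, v1, v2) \/ (u', v1', v2') = (u, v2, v1).
Proof.
move=> of1 of2; have b1 := open_fork_bond of1 of2.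
have b2 : [set u; v2] \in [set [set u'; v1']; [set u'; v2']].
  by apply: open_fork_bond of2; rewrite open_forkC in of1; exact: of1.
have [n1 n2 n12] : [/\ u != v1, u != v2 & v1 != v2].
  by case/and3P: of1 => _ _; apply: fork_neq.
have [n1' n2' n12'] : [/\ u' != v1', u' != v2' & v1' != v2'].
  by case/and3P: of2 => _ _; apply: fork_neq.
have pair_eq (a b c : T) : a != b -> [set a; b] = [set a; c] -> b = c.
  move=> ab E; have : b \in [set a; c] by rewrite -E !inE eqxx orbT.
  by rewrite !inE eq_sym (negPf ab) => /eqP.
have uu : u = u'.
  have : u \in [set u'; v1'] :&: [set u'; v2'].
    have inu v : u \in [set u; v] by rewrite !inE eqxx.
    move: b1 b2; rewrite !inE => /orP[]/eqP E1 /orP[]/eqP E2.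
    - by case/eqP: n12; apply: (pair_eq u) => //; rewrite E1 E2.
    - by have := inu v1; have := inu v2; rewrite E1 E2 !inE => -> ->.
    - by have := inu v1; have := inu v2; rewrite E1 E2 !inE => -> ->.
    - by case/eqP: n12; apply: (pair_eq u) => //; rewrite E1 E2.
  rewrite !inE; case: eqP => //= _ /andP[/eqP-> /eqP].
  by move/eqP: n12'.
rewrite -uu in b1 b2 *; move: b1 b2; rewrite !inE.
case/orP=> /eqP/(pair_eq _ _ _ n1) E1; case/orP=> /eqP/(pair_eq _ _ _ n2) E2; rewrite -?E1 -?E2.
- by move/eqP: n12; rewrite E1 E2.
- by left.
- by right.
- by move/eqP: n12; rewrite E1 E2.
Qed.

Definition bonds W : {set {set T}} := [set b in W | #|b| == 2].

Lemma conn_bonds W x y : conn (bonds W) x y = conn W x y.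
Proof.
apply/idP/idP; first by apply: conn_sub; apply/subsetP => b; rewrite inE => /andP[].
case/connectP=> p; elim: p x => [|z p IHp] x /=; first by move=> _ ->; apply: connect0.
case/andP=> xz zp /(IHp z zp) zy; case: (eqVneq x z) => [->//|xNz].
by apply: connect_trans zy; apply: connect1; rewrite /adj inE [_ \in W]xz cards2 xNz.
Qed.

Lemma cluster_bonds W x : cluster (bonds W) x = cluster W x.
Proof. by apply/setP => y; rewrite !inE conn_bonds. Qed.

End Connectivity.

(** * Exploration of clusters *)

Section Exploration.
Variables (R : realFieldType) (T : finType) (f : {set T} -> R).
Hypothesis f01 : forall b, 0 <= f b <= 1.
Implicit Types (W : {set {set T}}) (D S : {set T}) (x y z u v : T).

Definition tauf v z : R := prob f (fun W => conn W v z).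
Definition magf v : R := prob f (fun W => green W v).

Lemma tauf_ge0 v z : 0 <= tauf v z. Proof. exact: prob_ge0. Qed.
Lemma magf_ge0 v : 0 <= magf v. Proof. exact: prob_ge0. Qed.

Lemma tauf_sym v z : tauf v z = tauf z v.
Proof. by apply: eq_expect => W; rewrite conn_sym. Qed.

Lemma prob_exists_le (J : finType) (P : pred J) (A : J -> pred {set {set T}}) :
  prob f (fun W => [exists j, P j && A j W]) <= \sum_(j | P j) prob f (A j).
Proof.
rewrite -(expect_sum f P (fun j W => (A j W)%:R)); apply: expect_le => // W.
case E: [exists _, _]; last by rewrite sumr_ge0.
case/exists_inP: E => [j Pj AW]; rewrite (bigD1 j) //= AW lerDl sumr_ge0 //.
Qed.

Definition explored U S (X : {set {set T}} -> U) :=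
  forall W W', (forall b, b \in touch (reach S W) -> (b \in W) = (b \in W')) ->
  X W = X W'.

(** Given the vertex set [D] revealed from [S], the configuration off [D] is
    still distributed as before. *)
Lemma explore_sum S (X : {set {set T}} -> R) (Y : {set T} -> {set {set T}} -> R) :
  explored S X ->
  expect f (fun W => X W * Y (reach S W) (off (reach S W) W)) =
  \sum_D expect f (fun W => X W * (reach S W == D)%:R) *
         expect f (fun W => Y D (off D W)).
Proof.
move=> Xe; transitivity (\sum_D expect f (fun W =>
    X W * (reach S W == D)%:R * Y D (off D W))).
  rewrite -expect_sum; apply: eq_expect => W.
  rewrite (bigD1 (reach S W)) //= eqxx mulr1 big1 ?addr0 // => D.
  by rewrite eq_sym => /negPf->; rewrite mulr0 mul0r.
apply: eq_bigr => D _; apply: (expect_indep _ (s := enum (touch D))).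
  suff loc W W' : agree (enum (touch D)) W W' -> reach S W = D ->
      X W * (reach S W == D)%:R = X W' * (reach S W' == D)%:R.
    move=> W W' WW; case: (boolP (reach S W == D)) => [/eqP E|NE].
      by have := loc _ _ WW E; rewrite E eqxx.
    case: (boolP (reach S W' == D)) => [/eqP E|NE']; last by rewrite !mulr0.
    have WW' : agree (enum (touch D)) W' W by move=> b /WW.
    by have := loc _ _ WW' E; rewrite E eqxx (negPf NE).
  move=> WW E.
  have WWD b : b \in touch (reach S W) -> (b \in W) = (b \in W').
    by rewrite E => bD; apply: WW; rewrite mem_enum.
  by rewrite -(reach_local WWD) -(Xe _ _ WWD).
move=> W W' WW; congr (Y D _); apply/setP => b; rewrite !inE.
case: (boolP (b :&: D == set0)) => //= bD; apply: WW.
by rewrite mem_enum inE bD.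
Qed.

Lemma explore_total S (X : {set {set T}} -> R) :
  \sum_D expect f (fun W => X W * (reach S W == D)%:R) = expect f X.
Proof.
rewrite -expect_sum; apply: eq_expect => W; rewrite -mulr_sumr (bigD1 (reach S W)) //=.
by rewrite eqxx big1 ?addr0 ?mulr1 // => D; rewrite eq_sym => /negPf->.
Qed.

Lemma explore_le S (X : {set {set T}} -> R) (Y : {set {set T}} -> R) c :
  explored S X -> (forall W, 0 <= X W) ->
  (forall D, expect f (fun W => Y (off D W)) <= c) ->
  expect f (fun W => X W * Y (off (reach S W) W)) <= expect f X * c.
Proof.
move=> Xe X0 Yc; rewrite (explore_sum (fun=> Y)) // -(explore_total S X) mulr_suml.
apply: ler_sum => D _; apply: ler_wpM2l => //; apply: expect_ge0 => // W.
by rewrite mulr_ge0.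
Qed.

(** A connection to green that is lost off [D] visits [D] at some vertex, and its
    parts before and after that vertex occur disjointly. *)
Lemma green_off_ge D v :
  magf v - \sum_(z in D) tauf v z * magf z <= prob f (fun W => green (off D W) v).
Proof.
rewrite lerBlDr -lerBlDl.
apply: (@le_trans _ _ (prob f (fun W => [exists (z | z \in D),
    disj (fun W => conn W v z) (fun W => green W z) W]))).
  rewrite -expectB; apply: expect_le => // W; rewrite lerBlDl -natrD ler_nat.
  case gv: (green W v) => //; case: (boolP (green (off D W) v)) => //= goff.
  have [z zD zW] := green_through gv goff.
  by rewrite lt0b; apply/exists_inP; exists z.
apply: le_trans (prob_exists_le _ _) _; apply: ler_sum => z _.
by apply: bk => //; [apply: increasing_conn | apply: increasing_green].
Qed.

Lemma explore_green_ge S (X : {set {set T}} -> R) v :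
  explored S X -> (forall W, 0 <= X W) ->
  expect f X * magf v
    - \sum_z expect f (fun W => X W * (z \in reach S W)%:R) * (tauf v z * magf z)
  <= expect f (fun W => X W * (green (off (reach S W) W) v)%:R).
Proof.
move=> Xe X0; rewrite (explore_sum (fun _ W => (green W v)%:R)) //.
have EX D : 0 <= expect f (fun W => X W * (reach S W == D)%:R).
  by apply: expect_ge0 => // W; rewrite mulr_ge0.
apply: le_trans (ler_sum _ (fun D _ => ler_wpM2l (EX D) (green_off_ge D v))).
rewrite [leRHS](eq_bigr _ (fun D _ => mulrBr _ _ _)) sumrB -mulr_suml explore_total.
rewrite lerB // le_eqVlt; apply/orP; left; apply/eqP.
under eq_bigr do rewrite mulr_sumr big_mkcond /=.
rewrite exchange_big /=; apply: eq_bigr => z _.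
rewrite -[in RHS](explore_total S) [RHS]mulr_suml; apply: eq_bigr => D _.
case: ifP => zD.
  congr (_ * _); apply: eq_expect => W; case: eqP => [->|]; rewrite ?zD ?mulr0 ?mulr1 //.
rewrite (@expect_cst _ _ f _ 0) ?mul0r // => W.
by case: eqP => [->|]; rewrite ?zD ?mulr0 ?mul0r.
Qed.

Lemma prob_tripod v z : prob f (fun W => conn W v z && green W v) <=
  \sum_w tauf v w * (tauf w z * magf w).
Proof.
apply: (@le_trans _ _ (prob f (fun W => [exists (w | true), disj (fun W => conn W v w)
    (disj (fun W => conn W w z) (fun W => green W w)) W]))).
  by apply: prob_le => // W /andP[vz gv]; apply/existsP; apply: tripod.
apply: le_trans (prob_exists_le _ _) _; apply: ler_sum => w _.
have iG := @increasing_green T w.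
apply: le_trans (bk f01 (@increasing_conn _ v w) (disj_increasing iG)) _.
by rewrite ler_wpM2l ?tauf_ge0 //; apply: bk => //; apply: increasing_conn.
Qed.

Section Fork.
Variable m : R.
Hypothesis mE : forall v, magf v = m.

Definition dry x u : R := prob f (fun W => conn W x u && ~~ green W x).
Definition dry2 x u z : R := prob f (fun W => [&& conn W x u, conn W x z & ~~ green W x]).

Lemma dry_ge0 x u : 0 <= dry x u. Proof. exact: prob_ge0. Qed.

Lemma explored_natr S (A : pred {set {set T}}) :
  explored S A -> explored S (fun W => (A W)%:R : R).
Proof. by move=> Ae W W' /Ae->. Qed.

Lemma explored_dry x u : explored [set x] (fun W => conn W x u && ~~ green W x).
Proof.
by move=> W W' WW; rewrite -(conn_local _ _ WW) -?(green_local _ WW) ?inE.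
Qed.

Lemma explored_dry2 x u z :
  explored [set x] (fun W => [&& conn W x u, conn W x z & ~~ green W x]).
Proof.
by move=> W W' WW; rewrite -!(conn_local _ _ WW) -?(green_local _ WW) ?inE.
Qed.

Lemma green_off1 x v W : ~~ green W x -> green W v -> green (off (reach [set x] W) W) v.
Proof.
move=> xg gv; rewrite green_off gv andbT reach1 mem_cluster.
by apply: contra xg => /green_conn->.
Qed.

Let mE_off D v : prob f (fun W => green (off D W) v) <= m.
Proof. by rewrite -(mE v); apply: prob_le => // W; apply/green_sub/off_sub. Qed.

Lemma two_clusters_ge x u v :
  m * (dry x u - \sum_z dry2 x u z * tauf v z) <=
  prob f (fun W => [&& conn W x u, ~~ green W x & green W v]).
Proof.
pose X W : R := (conn W x u && ~~ green W x)%:R.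
have Xe : explored [set x] X by apply: explored_natr; apply: explored_dry.
have X0 W : 0 <= X W by rewrite ler0n.
apply: le_trans (le_trans (explore_green_ge v Xe X0) _); last first.
  apply: expect_le => // W; rewrite /X -natrM mulnb ler_nat green_off.
  by case: (conn W x u); case: (green W x); case: (green W v); case: (_ \notin _).
rewrite mE mulrBr mulrC lerB // mulr_sumr; apply: ler_sum => z _.
rewrite mE [tauf _ _ * m]mulrC mulrCA ler_wpM2l ?magf_ge0 //; first by rewrite -(mE x) magf_ge0.
rewrite ler_wpM2r ?tauf_ge0 //; apply: expect_le => // W.
rewrite /X -natrM mulnb ler_nat reach1 mem_cluster.
by case: (conn W x u); case: (green W x); case: (conn W x z).
Qed.

Lemma three_points_le x u v z :
  prob f (fun W => [&& conn W x u, ~~ green W x, green W v & conn W x z])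
  <= dry2 x u z * m.
Proof.
pose Y W : R := (green W v)%:R.
apply: le_trans (explore_le (Y := Y) (explored_natr (@explored_dry2 x u z)) _ (fun D => mE_off D v)).
  apply: expect_le => // W; rewrite /= /Y -natrM mulnb ler_nat.
  case gx: (green W x); rewrite /= ?andbF //.
  case gv: (green W v); rewrite /= ?andbF // green_off1 ?gx //.
  by rewrite !andbT.
by move=> W; apply: ler0n.
Qed.

Lemma disjoint_tripod_le x u v z :
  prob f (fun W => [&& conn W x u, ~~ green W x, green W v & conn W v z])
  <= dry x u * (m * \sum_w tauf v w * tauf w z).
Proof.
pose Y W : R := (conn W v z && green W v)%:R.
apply: le_trans (explore_le (Y := Y) (explored_natr (@explored_dry x u)) _ _).
- apply: expect_le => // W; rewrite /Y -natrM mulnb ler_nat.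
  case gx: (green W x); rewrite /= ?andbF //.
  case gv: (green W v); rewrite /= ?andbF // green_off1 ?gx //= !andbT.
  case: (conn W x u) => //=; rewrite conn_off //.
  rewrite reach1 mem_cluster; apply/negP => /green_conn; by rewrite gx gv.
- by move=> W; apply: ler0n.
move=> D; apply: (@le_trans _ _ (prob f (fun W => conn W v z && green W v))).
  apply: prob_le => // W /andP[vz gv].
  by rewrite (conn_sub (off_sub D W) vz) (green_sub (off_sub D W) gv).
apply: le_trans (prob_tripod v z) _; rewrite mulr_sumr.
by apply: ler_sum => w _; rewrite mE mulrA mulrC.
Qed.

(** Were the three clusters independent, the probability would be
    [dry x u * m ^ 2]. The corrections stand for the branch at [v1] meeting the
    cluster of [x], the branch at [v2] meeting it, and the two branches meeting
    each other; the last one is a triangle diagram. *)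
Lemma fork_ge x u v1 v2 :
  m ^+ 2 * (dry x u - \sum_z dry2 x u z * tauf v1 z - \sum_z dry2 x u z * tauf v2 z
     - dry x u * \sum_z \sum_w tauf v1 w * tauf w z * tauf z v2)
  <= prob f (fun W => fork W x u v1 v2).
Proof.
pose A W := [&& conn W x u, ~~ green W x & green W v1].
pose X W : R := (A W)%:R.
have Xe : explored [set x; v1] X.
  apply: explored_natr => W W' WW.
  by rewrite /A -!(conn_local _ _ WW) -?(green_local _ WW) ?inE ?eqxx ?orbT.
have X0 W : 0 <= X W by rewrite ler0n.
have m0 : 0 <= m by rewrite -(mE x) magf_ge0.
apply: le_trans (le_trans (explore_green_ge v2 Xe X0) _); last first.
  apply: expect_le => // W; rewrite /X -natrM mulnb ler_nat green_off /fork /A reach2.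
  rewrite in_setU negb_or !mem_cluster.
  case: (conn W x u); case: (green W x); case: (green W v1); case: (green W v2);
    case: (conn W v1 v2); by rewrite /= ?andbF ?andbT //; case: (conn W x v2).
rewrite mE.
apply: (@le_trans _ _ (m * (dry x u - \sum_z dry2 x u z * tauf v1 z) * m -
  \sum_z (dry2 x u z * m + dry x u * (m * \sum_w tauf v1 w * tauf w z)) * (tauf v2 z * m))).
  rewrite le_eqVlt; apply/orP; left; apply/eqP.
  have -> : \sum_z (dry2 x u z * m + dry x u * (m * \sum_w tauf v1 w * tauf w z)) * (tauf v2 z * m)
      = m ^+ 2 * (\sum_z dry2 x u z * tauf v2 z
                  + dry x u * \sum_z \sum_w tauf v1 w * tauf w z * tauf z v2).
    rewrite mulr_sumr -big_split mulr_sumr; apply: eq_bigr => z _ /=.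
    rewrite -mulr_suml (tauf_sym z v2); ring.
  by ring.
rewrite lerB //; first by rewrite ler_wpM2r //; apply: two_clusters_ge.
apply: ler_sum => z _; rewrite mE ler_wpM2r ?mulr_ge0 ?tauf_ge0 //.
apply: le_trans (lerD (three_points_le x u v1 z) (disjoint_tripod_le x u v1 z)).
rewrite -expectD; apply: expect_le => // W; rewrite /X -natrM -natrD mulnb ler_nat /A reach2.
rewrite in_setU !mem_cluster.
by case: (conn W x u); case: (green W x); case: (green W v1); case: (conn W x z);
  case: (conn W v1 z).
Qed.

End Fork.

(** Opening the two bonds at the root of a fork costs at most a factor [p ^ 2]. *)
Lemma open_fork_ge (p : R) x u v1 v2 : 0 <= p <= 1 -> f [set u; v1] = p -> f [set u; v2] = p ->
  p ^+ 2 * prob f (fun W => fork W x u v1 v2) <= prob f (fun W => open_fork W x u v1 v2).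
Proof.
move=> /andP[p0 p1] e1 e2.
have stp b (A : pred {set {set T}}) : f b = p -> p * prob f (fun W => A (b |: W)) <= prob f A.
  move=> fb; rewrite [leRHS](expect_step f b) fb lerDr mulr_ge0 ?subr_ge0 //.
  exact: prob_ge0.
apply: le_trans (stp _ _ e1); rewrite expr2 -mulrA ler_wpM2l //.
apply: le_trans (stp _ _ e2); rewrite ler_wpM2l //; apply: prob_le => // W fk.
have in1 b (A : {set {set T}}) : b \in b |: A by exact: setU11.
rewrite /open_fork in1 (setU1r _ (in1 _ _)) /=.
suff -> : ([set u; v1] |: ([set u; v2] |: W)) :\: [set [set u; v1]; [set u; v2]] = W.
  by [].
have /and5P[xu xg g1 g2 _] := fk; rewrite (green_conn xu) in xg.
have eNW v : green W v -> [set u; v] \notin W.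
  by apply: contraL => uv; rewrite -(@green_conn _ _ u v) //; apply: connect1.
apply/setP => b; rewrite !inE; case: eqP => [->|_]; first by rewrite (negPf (eNW _ g1)).
by case: eqP => [->|_] //=; rewrite (negPf (eNW _ g2)).
Qed.

(** The only freedom left by the configuration is the order of the two bonds. *)
Lemma sum_open_fork x W :
  (\sum_(t : T * T * T) open_fork W x t.1.1 t.1.2 t.2 <= 2 * green W x)%N.
Proof.
pose P (t : T * T * T) := open_fork W x t.1.1 t.1.2 t.2.
case: (pickP P) => [t tP|P0]; last by rewrite big1 // => t _; have := P0 t; rewrite /P => ->.
rewrite (open_fork_green tP) muln1.
have -> : (\sum_t P t = #|P|)%N by rewrite -sum1_card [RHS]big_mkcond; apply: eq_bigr => t' _; rewrite /= unfold_in.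
apply: leq_trans (_ : #|pred2 t (t.1.1, t.2, t.1.2)| <= 2)%N; last by rewrite card2; case: (_ != _).
apply: subset_leq_card; apply/subsetP => t' t'P; have := open_fork_unique tP t'P.
by rewrite !inE -!surjective_pairing => -[]->; rewrite eqxx ?orbT.
Qed.

End Exploration.

(** * Percolation with green vertices *)

Section Ghost.
Variables (R : realType) (T : finType) (B : {set {set T}}).
Hypothesis bondB : is_bond_set B.
Implicit Types (W w : {set {set T}}) (x y z u v : T) (p g : R).

Definition bond_law p (b : {set T}) : R := if b \in B then p else 0.
Definition vertex_law g (b : {set T}) : R := if #|b| == 1%N then g else 0.
Definition ghost p g (b : {set T}) : R := if b \in B then p else vertex_law g b.

Lemma ghost01 p g : 0 <= p <= 1 -> 0 <= g <= 1 -> forall b, 0 <= ghost p g b <= 1.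
Proof.
by move=> p01 g01 b; rewrite /ghost /vertex_law; do 2?case: ifP => // _; rewrite lexx ler01.
Qed.

Lemma bond_law01 p : 0 <= p <= 1 -> forall b, 0 <= bond_law p b <= 1.
Proof. by move=> p01 b; rewrite /bond_law; case: ifP => // _; rewrite lexx ler01. Qed.

Lemma Eperc_expect p X : Eperc B p X = expect (bond_law p) X.
Proof.
rewrite /Eperc big_mkcond; apply: eq_bigr => W _; case: ifPn => WB; last first.
  have [b bW bB] := subsetPn WB.
  by rewrite /wt (bigD1 b) //= bW /bond_law (negPf bB) !mul0r.
congr (_ * _); rewrite /wt (bigID (mem B)) /= [X in _ * X]big1 ?mulr1; last first.
  move=> b bB; have bW : b \notin W by apply: contra bB; apply: (subsetP WB).
  by rewrite (negPf bW) /bond_law (negPf bB) subr0.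
rewrite (bigID (mem W)) /= /perc_weight; congr (_ * _).
  rewrite (eq_bigl (mem W)) => [|b]; last first.
    by rewrite /= andbC; case bW: (b \in W) => //=; apply: (subsetP WB).
  rewrite (eq_bigr (fun=> p)) ?prodr_const // => b bW; rewrite [b \in W]bW /bond_law.
  by rewrite (subsetP WB).
rewrite (eq_bigl (mem (B :\: W))) => [|b]; last by rewrite !inE andbC.
rewrite (eq_bigr (fun=> 1 - p)) ?prodr_const // => b; rewrite !inE => /andP[bW bB].
by rewrite (negPf bW) /bond_law bB.
Qed.

Lemma eq_Eperc p X Y : X =1 Y -> Eperc B p X = Eperc B p Y.
Proof. by move=> XY; rewrite !Eperc_expect; apply: eq_expect. Qed.

Lemma Pperc_expect p (A : pred {set {set T}}) : Pperc B p A = prob (bond_law p) A.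
Proof.
rewrite /prob -Eperc_expect /Pperc /Eperc big_mkcondr; apply: eq_bigr => w _.
by case: (A w); rewrite ?mulr1 ?mulr0.
Qed.

Lemma expect_avoid (f : {set T} -> R) (K : {set {set T}}) :
  expect f (fun W => (W :&: K == set0)%:R) = \prod_(b in K) (1 - f b).
Proof.
rewrite (expect_restrict f K (fun W => (W == set0)%:R)) /expect (bigD1 set0) //=.
rewrite eqxx mulr1 big1 ?addr0 => [|W /negPf->]; last by rewrite mulr0.
rewrite [RHS]big_mkcond; apply: eq_bigr => b _; rewrite inE.
by case: ifP => // _; rewrite subr0.
Qed.

Lemma ghost_layers p g X :
  expect (ghost p g) X =
  expect (bond_law p) (fun W1 => expect (vertex_law g) (fun W2 => X (W1 :|: W2))).
Proof.
rewrite expect_layers; apply: eq_bigr => W _; congr (_ * _); apply: eq_bigr => b _.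
suff E : 1 - (1 - bond_law p b) * (1 - vertex_law g b) = ghost p g b by rewrite /= E.
rewrite /ghost /bond_law; case: ifP => bB; last by ring.
by rewrite /vertex_law (bondB bB) /=; ring.
Qed.

Lemma supp_bond p W : (forall b, b \in W -> bond_law p b != 0) -> W \subset B.
Proof. by move=> WB; apply/subsetP => b /WB; rewrite /bond_law; case: ifP; rewrite ?eqxx. Qed.

Lemma supp_vertex g W b : (forall b, b \in W -> vertex_law g b != 0) -> b \in W -> #|b| = 1%N.
Proof. by move=> WB /WB; rewrite /vertex_law; case: ifP => [/eqP //|_]; rewrite eqxx. Qed.

Lemma bonds_layers W1 W2 : W1 \subset B -> (forall b, b \in W2 -> #|b| = 1%N) ->
  bonds (W1 :|: W2) = W1.
Proof.
move=> W1B W2s; apply/setP => b; rewrite !inE.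
case bW1: (b \in W1) => /=; first by rewrite (bondB (subsetP W1B _ bW1)) eqxx.
by case bW2: (b \in W2); rewrite ?andbF // (W2s _ bW2).
Qed.

Lemma expect_ghost_bonds p g (phi : {set {set T}} -> R) :
  (forall W, phi (bonds W) = phi W) -> expect (ghost p g) phi = Eperc B p phi.
Proof.
move=> phiE; rewrite ghost_layers Eperc_expect; apply: expect_supp => W1 /supp_bond W1B.
rewrite -[RHS](expect_const (vertex_law g)); apply: expect_supp => W2 W2s.
by rewrite -phiE bonds_layers // => b; apply: supp_vertex W2s.
Qed.

Lemma expect_ghost_dry p g x (phi : {set {set T}} -> R) :
  (forall W, phi (bonds W) = phi W) ->
  expect (ghost p g) (fun W => phi W * (~~ green W x)%:R) =
  Eperc B p (fun w => phi w * (1 - g) ^+ #|cluster w x|).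
Proof.
move=> phiE; rewrite ghost_layers Eperc_expect; apply: expect_supp => W1 /supp_bond W1B.
pose K := [set [set z] | z in cluster W1 x].
transitivity (expect (vertex_law g) (fun W2 => phi W1 * (W2 :&: K == set0)%:R)).
  apply: expect_supp => W2 W2s.
  have bE : bonds (W1 :|: W2) = W1 by apply: bonds_layers => // b; apply: supp_vertex W2s.
  rewrite -[phi (_ :|: _)]phiE bE; congr (_ * (_ : bool)%:R).
  apply/idP/eqP => [xg|K0].
    apply/setP => b; rewrite in_set0 inE; apply/andP => -[bW2 /imsetP[z]].
    rewrite mem_cluster => xz bz; case/negP: xg; apply/greenP; exists z.
      by rewrite -conn_bonds bE.
    by rewrite inE -bz bW2 orbT.
  apply/negP => /greenP[z]; rewrite -conn_bonds bE => xz.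
  rewrite inE => /orP[/(subsetP W1B)/bondB|zW2]; first by rewrite cards1.
  have := in_set0 [set z]; rewrite -K0 inE zW2 /= => /negP; apply.
  by apply/imsetP; exists z; rewrite ?mem_cluster.
rewrite expectZ expect_avoid; congr (_ * _).
rewrite (eq_bigr (fun=> 1 - g)) ?prodr_const ?card_imset //; first exact: set1_inj.
by move=> b /imsetP[z _ ->]; rewrite /vertex_law cards1.
Qed.

(** The magnetization: the mean over the bonds of the probability that the
    cluster of [x] has a green vertex. *)
Definition mag p g x : R := Eperc B p (fun w => 1 - (1 - g) ^+ #|cluster w x|).

Lemma prob_conn_green p g x y :
  prob (ghost p g) (fun W => conn W x y && green W x) =
  Eperc B p (fun w => (conn w x y)%:R * (1 - (1 - g) ^+ #|cluster w x|)).
Proof.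
pose phi W : R := (conn W x y)%:R.
have phiE W : phi (bonds W) = phi W by rewrite /phi conn_bonds.
transitivity (expect (ghost p g) phi - expect (ghost p g) (fun W => phi W * (~~ green W x)%:R)).
  rewrite -expectB; apply: eq_expect => W; rewrite /phi.
  by case: (conn W x y); case: (green W x); rewrite /= ?mulr0 ?mulr1 ?subr0 ?subrr.
rewrite expect_ghost_bonds // expect_ghost_dry // !Eperc_expect -expectB.
by apply: eq_expect => W; rewrite mulrBr mulr1.
Qed.

Lemma magf_ghost p g x : magf (ghost p g) x = mag p g x.
Proof.
transitivity (prob (ghost p g) (fun W => conn W x x && green W x)).
  by apply: eq_expect => W; rewrite connect0.
by rewrite prob_conn_green; apply: eq_Eperc => w; rewrite connect0 mul1r.
Qed.

Lemma tauf_ghost p g x y : tauf (ghost p g) x y = tau B p x y.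
Proof.
rewrite /tau Pperc_expect /prob -Eperc_expect -(expect_ghost_bonds p g) //.
by move=> W; rewrite conn_bonds.
Qed.

Lemma cluster_aut (s : {perm T}) W x :
  #|cluster [set s @: b | b : {set T} in W] (s x)| = #|cluster W x|.
Proof.
have sinj : injective (fun b : {set T} => s @: b) by apply/imset_inj/perm_inj.
set W' := [set _ | b in W].
have adjE u v : adj W' (s u) (s v) = adj W u v.
  by rewrite /adj /W' -[RHS](mem_imset W [set u; v] sinj) /= imsetU1 imset_set1.
rewrite -[RHS](card_imset _ (@perm_inj _ s)); apply: eq_card => y.
rewrite -[y](permKV s) mem_cluster (mem_imset _ _ (@perm_inj _ s)) mem_cluster.
suff key : forall z, conn W x z = conn W' (s x) (s z) by rewrite key.
move=> z; apply/idP/idP => xz.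
  have : z \in [set z | s z \in cluster W' (s x)].
    apply: conn_closed xz; last by rewrite !inE connect0.
    move=> u v; rewrite !inE => xu uv; apply: connect_trans xu (connect1 _).
    by rewrite adjE.
  by rewrite !inE.
have : s z \in [set y | s^-1%g y \in cluster W x].
  apply: conn_closed xz; last by rewrite !inE permK connect0.
  move=> u v; rewrite !inE => xu uv; apply: connect_trans xu (connect1 _).
  by rewrite -adjE !permKV.
by rewrite !inE permK.
Qed.

Hypothesis transB : transitive_graph B.

Lemma Eperc_cluster_size p (phi : nat -> R) x y :
  Eperc B p (fun w => phi #|cluster w x|) = Eperc B p (fun w => phi #|cluster w y|).
Proof.
have [s saut <-] := transB x y.
have sinj : injective (fun b : {set T} => s @: b) by apply/imset_inj/perm_inj.
rewrite !Eperc_expect (expect_inj (fun W => phi #|cluster W (s x)|) sinj).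
  by apply: eq_expect => W; rewrite cluster_aut.
move=> b; rewrite /bond_law.
have cardE : #|s @: b| = #|b| by apply/card_imset/perm_inj.
suff -> : (s @: b \in B) = (b \in B) by [].
case: (eqVneq #|b| 2%N) => [|b2].
  move/eqP/cards2P => [u [v [_ ->]]]; have := saut u v.
  by rewrite /adj imsetU1 imset_set1.
apply/idP/idP => /bondB; first by rewrite cardE => /eqP; rewrite (negPf b2).
by move/eqP; rewrite (negPf b2).
Qed.

End Ghost.

(** * The fork inequality *)

Section ForkInequality.
Variables (R : realType) (T : finType) (B : {set {set T}}) (o : T) (Omega : nat).
Hypotheses (bondB : is_bond_set B) (transB : transitive_graph B).
Hypothesis degB : forall x, degree B x = Omega.
Variables (p g a : R).
Hypotheses (p01 : 0 <= p <= 1) (g0 : 0 < g) (g1 : g <= 1).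
Hypothesis triB : forall x y, triangle B p x y <= (x == y)%:R + a.
Implicit Types (x y z u v : T).

(** As a function of [g], this is [1 - g] times the derivative of [mag B p g o]. *)
Definition dry_size : R := Eperc B p (fun w => #|cluster w o|%:R * (1 - g) ^+ #|cluster w o|).

Let f := ghost B p g.
Let f01 : forall b, 0 <= f b <= 1.
Proof. by apply: ghost01; rewrite // g1 ltW. Qed.
Let m := mag B p g o.

Let mag_const x : mag B p g x = mag B p g o.
Proof. exact: (Eperc_cluster_size bondB transB p (fun n => 1 - (1 - g) ^+ n)). Qed.

Let mE v : magf f v = m.
Proof. by rewrite magf_ghost // mag_const. Qed.

Let m0 : 0 <= m. Proof. by rewrite -(mE o); exact: magf_ge0. Qed.

Let sum_dry x : \sum_u dry f x u = dry_size.
Proof.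
rewrite /dry_size.
rewrite -(Eperc_cluster_size bondB transB p (fun n => n%:R * (1 - g) ^+ n) x).
rewrite -expect_sum -(expect_ghost_dry bondB p g x (phi := fun w => #|cluster w x|%:R)).
  apply: eq_expect => W; rewrite -sum1_card natr_sum mulr_suml [RHS]big_mkcond /=.
  apply: eq_bigr => u _; rewrite mem_cluster mul1r.
  by case: (conn W x u).
by move=> W; rewrite cluster_bonds.
Qed.

Lemma geom_le (n : nat) : g * (n%:R * (1 - g) ^+ n) <= 1 - (1 - g) ^+ n.
Proof.
have q0 : 0 <= 1 - g by rewrite subr_ge0.
have q1 : 1 - g <= 1 by rewrite gerBl ltW.
elim: n => [|n IHn]; first by rewrite mul0r mulr0 expr0 subrr.
have : g * (1 - g) ^+ n.+1 <= g.
  by rewrite ler_piMr ?(ltW g0) // exprn_ile1.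
have := ler_wpM2l q0 IHn; rewrite exprS -natr1.
by move: ((1 - g) ^+ n) => Q; lra.
Qed.

(** The sum over [x] counts the vertices of the cluster of [u]. Since that cluster
    is not green, its size costs no more than a factor [g^-1] ([geom_le]), and it
    may then be taken to be green, which leaves an increasing event. *)
Let sum_dry2 u z : \sum_x dry2 f x u z <= g^-1 * (m * \sum_w tau B p u w * tau B p w z).
Proof.
apply: (@le_trans _ _ (g^-1 * prob f (fun W => conn W u z && green W u))); last first.
  rewrite ler_wpM2l ?invr_ge0 ?(ltW g0) //; apply: le_trans (prob_tripod f01 u z) _.
  rewrite mulr_sumr; apply: ler_sum => w _; rewrite mE !tauf_ghost //.
  by rewrite mulrA mulrC.
rewrite ler_pdivlMl // prob_conn_green // Eperc_expect.
rewrite -expect_sum -expectZ.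
have -> : expect f (fun W => g * \sum_x ([&& conn W x u, conn W x z & ~~ green W x])%:R) =
   expect f (fun W => (g * (#|cluster W u|%:R * (conn W u z)%:R)) * (~~ green W u)%:R).
  apply: eq_expect => W; rewrite -mulrA -sum1_card natr_sum; congr (_ * _).
  rewrite !mulr_suml [RHS]big_mkcond; apply: eq_bigr => x _ /=.
  rewrite mem_cluster mul1r conn_sym; case ux: (conn W u x) => //=.
  rewrite (green_conn ux) -natrM mulnb; congr ((_ && _)%:R).
  by apply/idP/idP => H; [apply: connect_trans ux H | apply: connect_trans H; rewrite conn_sym].
rewrite expect_ghost_dry // ?Eperc_expect; last by move=> W; rewrite cluster_bonds conn_bonds.
apply: expect_le => [|w]; first exact: bond_law01.
rewrite -mulrA [_ * (conn _ _ _)%:R * _]mulrAC mulrA mulrC ler_wpM2l //.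
exact: geom_le.
Qed.

Let excess x u v : R := \sum_z dry2 f x u z * tau B p v z.

Let excess_sum u v : u != v -> \sum_x excess x u v <= m / g * a.
Proof.
move=> uv; rewrite exchange_big /=.
apply: (@le_trans _ _ (\sum_z (g^-1 * (m * \sum_w tau B p u w * tau B p w z)) * tau B p v z)).
  apply: ler_sum => z _; rewrite -mulr_suml ler_wpM2r ?sum_dry2 //.
  by rewrite -(tauf_ghost bondB p g) tauf_ge0.
have := triB u v; rewrite (negPf uv) add0r => /(ler_wpM2l (mulr_ge0 m0 _)) H.
have {H}: m / g * triangle B p u v <= m / g * a by apply: H; rewrite invr_ge0 ltW.
apply: le_trans; rewrite le_eqVlt; apply/orP; left; apply/eqP.
rewrite /triangle exchange_big /= mulr_sumr; apply: eq_bigr => z _.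
rewrite -mulr_suml -!(tauf_ghost bondB p g) (tauf_sym _ z v); ring.
Qed.

Let fork_pair x u v1 v2 : v1 != v2 ->
  m ^+ 2 * (dry f x u * (1 - a) - excess x u v1 - excess x u v2)
  <= prob f (fun W => fork W x u v1 v2).
Proof.
move=> v12; apply: le_trans (fork_ge f01 mE x u v1 v2); rewrite ler_wpM2l ?exprn_ge0 //.
rewrite /excess; under [X in _ - X - _ <= _]eq_bigr do rewrite -(tauf_ghost bondB p g).
under [X in _ - X <= _]eq_bigr do rewrite -(tauf_ghost bondB p g).
have := triB v1 v2; rewrite (negPf v12) add0r => /(ler_wpM2l (dry_ge0 f01 x u)).
rewrite /triangle exchange_big /=.
under eq_bigr do under eq_bigr do rewrite -!(tauf_ghost bondB p g).
rewrite -/f; lra.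
Qed.

Let sum_open x : \sum_u \sum_(v1 | adj B u v1) \sum_(v2 | adj B u v2 && (v2 != v1))
  p ^+ 2 * prob f (fun W => fork W x u v1 v2) <= 2 * m.
Proof.
apply: (@le_trans _ _ (\sum_u \sum_v1 \sum_v2 prob f (fun W => open_fork W x u v1 v2))).
  apply: ler_sum => u _; rewrite big_mkcond; apply: ler_sum => v1 _.
  case: ifP => uv1; last by apply: sumr_ge0 => v2 _; apply: prob_ge0.
  rewrite big_mkcond; apply: ler_sum => v2 _.
  case: ifP => [/andP[uv2 _]|_]; last exact: prob_ge0.
  have fB v : adj B u v -> f [set u; v] = p by rewrite /adj /f /ghost => ->.
  by apply: open_fork_ge; rewrite ?fB.
rewrite -(mE x) -expectZ.
rewrite pair_bigA /= pair_bigA /= -expect_sum; apply: expect_le => // W.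
by rewrite -natr_sum -natrM ler_nat; apply: sum_open_fork.
Qed.

Let card_adj u : #|[pred v | adj B u v]| = Omega.
Proof. by rewrite -(degB u) /degree cardsE. Qed.

(** The inequality is first averaged over the starting point [x] of the forks:
    only then do the error terms of [fork_pair] close up to triangle diagrams
    ([excess_sum]). *)
Lemma fork_inequality :
  p ^+ 2 * (Omega%:R * (Omega%:R - 1)) * mag B p g o ^+ 2
    * ((1 - a) * dry_size - 2 * a * (mag B p g o / g)) <= 2 * mag B p g o.
Proof.
rewrite -/m.
have V0 : 0 < #|T|%:R :> R by rewrite ltr0n; apply/card_gt0P; exists o.
case: (posnP Omega) => [->|Om_gt0]; first by rewrite mul0r mulr0 !mul0r mulr_ge0.
have Om1 : 0 <= Omega%:R - 1 :> R by rewrite subr_ge0 ler1n.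
pose L x := \sum_u \sum_(v1 | adj B u v1) \sum_(v2 | adj B u v2 && (v2 != v1))
  p ^+ 2 * (m ^+ 2 * (dry f x u * (1 - a) - excess x u v1 - excess x u v2)).
have L_le x : L x <= 2 * m.
  apply: le_trans (sum_open x); apply: ler_sum => u _; apply: ler_sum => v1 _.
  apply: ler_sum => v2 /andP[_ v21]; rewrite ler_wpM2l ?exprn_ge0 //; first by case/andP: p01.
  by apply: fork_pair; rewrite eq_sym.
have card2 u v1 : adj B u v1 -> #|[pred v2 | adj B u v2 && (v2 != v1)]|%:R = Omega%:R - 1 :> R.
  move=> uv1; have -> : Omega = (1 + #|[pred v2 | adj B u v2 && (v2 != v1)]|)%N.
    rewrite -(card_adj u) (cardD1 v1) [v1 \in _]uv1; congr (_ + _)%N.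
    by apply: eq_card => v; rewrite !inE andbC.
  by rewrite natrD addrAC subrr add0r.
have LE x : L x = p ^+ 2 * m ^+ 2 * (Omega%:R * (Omega%:R - 1) * (1 - a) * dry_size
   - 2 * (Omega%:R - 1) * \sum_u \sum_(v | adj B u v) excess x u v).
  rewrite /L -(sum_dry x).
  have E1 u : \sum_(v1 | adj B u v1) \sum_(v2 | adj B u v2 && (v2 != v1)) dry f x u =
      Omega%:R * (Omega%:R - 1) * dry f x u.
    rewrite (eq_bigr (fun=> (Omega%:R - 1) * dry f x u)) => [|v1 uv1].
      by rewrite sumr_const card_adj -[LHS]mulr_natl mulrA.
    by rewrite sumr_const -[LHS]mulr_natl card2.
  have E2 u : \sum_(v1 | adj B u v1) \sum_(v2 | adj B u v2 && (v2 != v1)) excess x u v1 =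
      (Omega%:R - 1) * \sum_(v | adj B u v) excess x u v.
    by rewrite mulr_sumr; apply: eq_bigr => v1 uv1; rewrite sumr_const -[LHS]mulr_natl card2.
  have E3 u : \sum_(v1 | adj B u v1) \sum_(v2 | adj B u v2 && (v2 != v1)) excess x u v2 =
      (Omega%:R - 1) * \sum_(v | adj B u v) excess x u v.
    rewrite -E2 (exchange_big_dep (adj B u)) /=; last by move=> ? ? _ /andP[].
    apply: eq_bigr => v2 uv2; apply: eq_bigl => v1; rewrite uv2 /=.
    by rewrite [v2 == v1]eq_sym.
  rewrite !mulr_sumr -sumrB mulr_sumr; apply: eq_bigr => u _.
  have -> : \sum_(v1 | adj B u v1) \sum_(v2 | adj B u v2 && (v2 != v1))
      p ^+ 2 * (m ^+ 2 * (dry f x u * (1 - a) - excess x u v1 - excess x u v2)) =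
    p ^+ 2 * m ^+ 2 * ((1 - a) * (\sum_(v1 | adj B u v1) \sum_(v2 | adj B u v2 && (v2 != v1)) dry f x u)
     - \sum_(v1 | adj B u v1) \sum_(v2 | adj B u v2 && (v2 != v1)) excess x u v1
     - \sum_(v1 | adj B u v1) \sum_(v2 | adj B u v2 && (v2 != v1)) excess x u v2).
    rewrite mulr_sumr -!sumrB mulr_sumr; apply: eq_bigr => v1 _.
    rewrite mulr_sumr -!sumrB mulr_sumr; apply: eq_bigr => v2 _.
    by ring.
  by rewrite E1 E2 E3; ring.
have sumL : \sum_x L x <= #|T|%:R * (2 * m).
  by rewrite mulr_natl -sumr_const; apply: ler_sum => x _.
have ex_le : \sum_x \sum_u \sum_(v | adj B u v) excess x u v <= #|T|%:R * (Omega%:R * (m / g * a)).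
  rewrite exchange_big /= mulr_natl -sumr_const; apply: ler_sum => u _.
  rewrite exchange_big /= mulr_natl -(card_adj u) -sumr_const.
  apply: ler_sum => v uv; apply: excess_sum.
  by apply: contraTneq uv => ->; rewrite /adj; apply/negP => /bondB; rewrite setUid cards1.
rewrite -(ler_pM2l V0); apply: le_trans sumL.
rewrite (eq_bigr _ (fun x _ => LE x)) -mulr_sumr sumrB sumr_const -mulr_sumr -[_ *+ _]mulr_natl.
have pm : 0 <= p ^+ 2 * m ^+ 2 by rewrite mulr_ge0 ?exprn_ge0 //; case/andP: p01.
have := ler_wpM2l pm (ler_wpM2l Om1 ex_le).
by move: (\sum_x \sum_u _) => e; lra.
Qed.

End ForkInequality.

(** * The square-root law for the magnetization *)

(** Either the maximum is not positive, or it is attained inside and is critical. *)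
Lemma poly_max (R : realType) (q : {poly R}) : q.[0] = 0 -> q.[1] = 0 ->
  exists2 c, 0 <= c <= 1 /\ (forall t, 0 <= t <= 1 -> q.[t] <= q.[c])
    & q.[c] <= 0 \/ [/\ 0 < c, c < 1 & q^`().[c] = 0].
Proof.
move=> q0 q1.
have cq : continuous (horner q) by apply: continuous_horner.
have [c] := @EVT_max R (horner q) 0 1 ler01 (continuous_subspaceT cq).
rewrite in_itv /= => c01 cmax; exists c.
  by split=> // t t01; apply: cmax; rewrite in_itv.
have [|qc] := lerP q.[c] 0; [by left | right].
have c_gt0 : 0 < c.
  by rewrite lt_neqAle; case/andP: c01 => -> _; rewrite andbT; apply: contraTneq qc => <-; rewrite q0 ltxx.
have c_lt1 : c < 1.
  by rewrite lt_neqAle; case/andP: c01 => _ ->; rewrite andbT; apply: contraTneq qc => ->; rewrite q1 ltxx.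
split=> //.
have [] := @derive1_at_max R (horner q) 0 1 c ler01.
- by move=> t _; apply: derivable_horner.
- by rewrite in_itv /= c_gt0.
- by move=> t; rewrite in_itv /= => /andP[t0 t1]; apply: cmax; rewrite in_itv /= !ltW.
by move=> _; rewrite derivE derive1E.
Qed.

Lemma one_sub_geom (A : comNzRingType) (x : A) (k : nat) :
  1 - (1 - x) ^+ k = x * \sum_(i < k) (1 - x) ^+ i.
Proof.
have := subrXX 1 (1 - x) k; rewrite expr1n subKr => ->.
by congr (_ * _); apply: eq_bigr => i _; rewrite expr1n mul1r.
Qed.

Section SquareRoot.
Variables (R : realType) (T : finType) (B : {set {set T}}) (o : T) (p : R).
Hypothesis p01 : 0 <= p <= 1.

Let wgt (w : {set {set T}}) : R := if w \subset B then perc_weight B p w else 0.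

Let EpercE (X : {set {set T}} -> R) : Eperc B p X = \sum_w wgt w * X w.
Proof.
rewrite /Eperc big_mkcond; apply: eq_bigr => w _; rewrite /wgt.
by case: ifP => _; rewrite ?mul0r.
Qed.

Let n (w : {set {set T}}) := #|cluster w o|.

Let N : {poly R} := \sum_w wgt w *: \sum_(k < n w) (1 - 'X) ^+ k.

Let N_mag g : mag B p g o = g * N.[g].
Proof.
rewrite /mag EpercE /N horner_sum mulr_sumr; apply: eq_bigr => w _.
rewrite hornerZ mulrCA; congr (_ * _).
rewrite one_sub_geom horner_sum; congr (_ * _); apply: eq_bigr => k _.
by rewrite !hornerE.
Qed.

Let magpoly : 'X * N = \sum_w wgt w *: (1 - (1 - 'X) ^+ n w).
Proof.
by rewrite /N mulr_sumr; apply: eq_bigr => w _; rewrite -scalerAr one_sub_geom.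
Qed.

Let dry_deriv g : dry_size B o p g = (1 - g) * (N.[g] + g * N^`().[g]).
Proof.
have -> : N.[g] + g * N^`().[g] = ('X * N)^`().[g] by rewrite derivM derivX !hornerE.
rewrite magpoly /dry_size EpercE raddf_sum horner_sum mulr_sumr; apply: eq_bigr => w _.
rewrite /= derivZ hornerZ [RHS]mulrCA; congr (_ * _).
rewrite derivB deriv_exp derivB derivC derivX !hornerE hornerMn !hornerE.
rewrite /n; case: #|cluster w o| => [|k] /=.
  by rewrite mul0r mulr0n oppr0 mulr0.
by rewrite exprS -[_ *+ k.+1]mulr_natl; ring.
Qed.

Let root_of_max c : 0 < c -> c < 1 -> ((1 - 'X) * 'X * N ^+ 2)^`().[c] = 0 -> N.[c] != 0 ->
  dry_size B o p c = N.[c] / 2.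
Proof.
move=> c0 c1 + Nc; rewrite dry_deriv !derivM derivB derivC derivX !hornerE.
move=> /= E; apply: (mulfI Nc); move: E; move: N.[c] N^`().[c] => x y.
rewrite -[_ + - c]/(-1 * c + 1 - c) => E; lra.
Qed.

Variables (a kappa : R).
Hypotheses (a1 : 5 * a < 1) (k0 : 0 < kappa).
Hypothesis fork_ineq : forall g, 0 < g -> g <= 1 ->
  kappa * mag B p g o ^+ 2 * ((1 - a) * dry_size B o p g - 2 * a * (mag B p g o / g))
  <= 2 * mag B p g o.

(** At a maximum of [(1 - g) * mag ^ 2 / g] over [0, 1] the derivative identifies
    the expected size of a cluster without green vertices as [mag / (2 * g)]. *)
Lemma mag_sqrt g : 0 <= g <= 1 ->
  kappa * (1 - 5 * a) * ((1 - g) * mag B p g o ^+ 2) <= 4 * g.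
Proof.
move=> /andP[g0 g1].
pose q : {poly R} := (1 - 'X) * 'X * N ^+ 2.
have qE t : q.[t] = (1 - t) * t * N.[t] ^+ 2 by rewrite /q !hornerE.
have [] := @poly_max R q; first by rewrite qE mulr0 mul0r.
  by rewrite qE subrr !mul0r.
move=> c [/andP[c0 c1] /(_ g)]; rewrite g0 g1 => /(_ isT) qg qc.
have -> : (1 - g) * mag B p g o ^+ 2 = g * q.[g] by rewrite N_mag qE; ring.
have ka : 0 < kappa * (1 - 5 * a) by rewrite mulr_gt0 // subr_gt0.
suff : kappa * (1 - 5 * a) * q.[c] <= 4.
  move=> H; rewrite mulrCA [leRHS]mulrC ler_wpM2l //; apply: le_trans H.
  by rewrite ler_pM2l.
case: qc => [qc|[c_gt0 c_lt1 qc]].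
  by apply: (@le_trans _ _ 0) => //; rewrite pmulr_rle0.
have [N0|N0] := eqVneq N.[c] 0; first by rewrite qE N0 expr0n /= !mulr0.
have := fork_ineq c_gt0 (ltW c_lt1); rewrite (root_of_max c_gt0 c_lt1 qc N0) N_mag qE.
have N_gt0 : 0 < N.[c].
  rewrite lt_neqAle eq_sym N0 /= -(pmulr_rge0 _ c_gt0) -N_mag.
  rewrite /mag EpercE; apply: sumr_ge0 => w _; rewrite mulr_ge0 //.
    rewrite /wgt; case: ifP => // _; case/andP: p01 => p0 p1.
    by rewrite mulr_ge0 // exprn_ge0 // subr_ge0.
  by rewrite subr_ge0 exprn_ile1 // ?subr_ge0 ?gerBl ltW.
rewrite [c * _]mulrC mulfK ?gt_eqF //; move: N.[c] N_gt0 => x x0.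
have -> : kappa * (x * c) ^+ 2 * ((1 - a) * (x / 2) - 2 * a * x)
  = (x * c) * (kappa * (1 - 5 * a) * (c * x ^+ 2) / 2) by field.
rewrite [leRHS]mulrC ler_pM2l ?mulr_gt0 // => H.
have y0 : 0 <= kappa * (1 - 5 * a) * (c * x ^+ 2).
  by rewrite mulr_ge0 ?ltW // mulr_gt0 // exprn_gt0.
rewrite -(mulrA (1 - c)) mulrCA; move: y0 H; move: (kappa * _ * _) => y y0 H.
have : (1 - c) * y <= y by rewrite ler_piMl // gerBl ltW.
by lra.
Qed.

End SquareRoot.

(** * Sprinkling bonds *)

Section HarrisProd.
Variables (R : realFieldType) (I : finType) (f : I -> R).
Hypothesis f01 : forall i, 0 <= f i <= 1.

Lemma harris_prod (J : Type) (s : seq J) (P : pred J) (X : J -> {set I} -> R) :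
  (forall j, decreasing (X j)) -> (forall j W, 0 <= X j W) ->
  \prod_(j <- s | P j) expect f (X j) <= expect f (fun W => \prod_(j <- s | P j) X j W).
Proof.
move=> Xd X0; elim: s => [|j s IHs].
  rewrite big_nil (@expect_cst _ _ f _ 1) // => W; exact: big_nil.
rewrite big_cons; have [Pj|Pj] := boolP (P j); last first.
  by apply: le_trans IHs _; apply: expect_le => // W; rewrite big_cons (negPf Pj).
apply: le_trans (ler_wpM2l (expect_ge0 f01 (X0 j)) IHs) _.
apply: le_trans (harris f01 (Xd j) _) _.
  move=> W W' WW; apply: ler_prod => i _; rewrite X0 /=; exact: Xd.
by apply: expect_le => // W; rewrite big_cons Pj.
Qed.

Lemma expect_mem i : expect f (fun W => (i \in W)%:R) = f i.
Proof.
rewrite (expect_step f i) (@expect_cst _ _ f _ 0) => [|W]; last by rewrite !inE eqxx.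
by rewrite (@expect_cst _ _ f _ 1) ?mulr0 ?add0r ?mulr1 // => W; rewrite setU11.
Qed.

End HarrisProd.

Section Extrapolation.
Variables (R : realType) (T : finType) (B : {set {set T}}) (o : T) (Omega : nat).
Hypotheses (bondB : is_bond_set B) (transB : transitive_graph B).
Hypothesis degB : forall x, degree B x = Omega.
Variables (q s p g : R).
Hypotheses (q01 : 0 <= q <= 1) (s01 : 0 <= s <= 1) (p01 : 0 <= p <= 1) (g01 : 0 <= g <= 1).
Hypothesis pE : 1 - p = (1 - q) * (1 - s).
Implicit Types (W : {set {set T}}) (D : {set T}) (u v x : T).

Let m := mag B p g o.
Let f1 := bond_law B q.
Let f2 := ghost B s g.
Let f := ghost B p g.
Let f101 : forall b, 0 <= f1 b <= 1. Proof. exact: bond_law01. Qed.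
Let f201 : forall b, 0 <= f2 b <= 1. Proof. exact: ghost01. Qed.
Let f01 : forall b, 0 <= f b <= 1. Proof. exact: ghost01. Qed.

Let fE b : 1 - (1 - f1 b) * (1 - f2 b) = f b.
Proof.
rewrite /f1 /f2 /f /bond_law /ghost; case: ifP => _; last by ring.
by rewrite -pE subKr.
Qed.

Let mE x : mag B p g x = m.
Proof. exact: (Eperc_cluster_size bondB transB p (fun n => 1 - (1 - g) ^+ n)). Qed.

(** The indicators [gate] and [shut] say that no green vertex is reached from [D]:
    [W] holds the sprinkled layer at [D] and both layers off [D]. *)
Let gate D W u v : R := (~~ (([set u; v] \in W) && green (off D W) v))%:R.

Let shut D W : R := \prod_(u in D) (([set u] \notin W)%:R * \prod_(v in ~: D) gate D W u v).

Let off_mono D W W' : W \subset W' -> off D W \subset off D W'.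
Proof. exact: setSD. Qed.

Let gate_dec D u v : decreasing (fun W => gate D W u v).
Proof.
move=> W W' WW; rewrite /gate ler_nat.
case: (boolP (([set u; v] \in W) && green (off D W) v)) => [/andP[uvW gv]|_]; last by case: (_ && _).
rewrite (subsetP WW _ uvW) /=.
by rewrite (green_sub (off_mono D WW) gv).
Qed.

Let shut_le x W1 W2 : W1 \subset B ->
  shut (cluster W1 x) (off (cluster W1 x) W1 :|: W2) <= (~~ green (W1 :|: W2) x)%:R.
Proof.
move=> W1B; set D := cluster W1 x; set W := off D W1 :|: W2.
case: (boolP (green (W1 :|: W2) x)) => [gx|_]; last first.
  apply: prodr_ile1 => u _; rewrite mulr_ge0 ?prodr_ge0 //=.
  rewrite mulr_ile1 ?prodr_ge0 //; first by case: (_ \notin _).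
  apply: prodr_ile1 => v _; rewrite ler0n /gate /=.
  by case: (~~ _).
suff : shut D W = 0 by move=> ->.
apply/eqP/negPn/negP; rewrite /shut prodf_seq_neq0 => /allP H.
have D1 u : u \in D -> [set u] \notin W /\ forall v, v \notin D ->
    [set u; v] \in W -> ~~ green (off D W) v.
  move=> uD; have := H u (mem_index_enum u); rewrite uD /= mulf_eq0 negb_or.
  case/andP=> uW; rewrite prodf_seq_neq0 => /allP H2; split.
    by move: uW; case: (_ \notin _); rewrite // eqxx.
  move=> v vD uvW; have := H2 v (mem_index_enum v); rewrite in_setC vD /= /gate uvW /=.
  by case: (green _ _); rewrite // eqxx.
have Dcl u v : u \in D -> [set u; v] \in W1 -> v \in D.
  by rewrite !mem_cluster => xu uv; apply: connect_trans xu (connect1 uv).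
have Wof b : b \notin touch D -> b \in W1 :|: W2 -> b \in off D W.
  by move=> bD; rewrite in_setD bD /W /off in_setU !in_setD bD in_setU.
case/greenP: gx => z xz zW.
have : z \in [set y | (y \in D) || ~~ green (off D W) y].
  apply: conn_closed xz; last by rewrite inE cluster_refl.
  move=> y y'; rewrite inE => yS yy'; rewrite inE; case: (boolP (y' \in D)) => //= y'D.
  case: (boolP (y \in D)) yS => /= [yD _|yD yg].
    have [_ /(_ y' y'D)] := D1 y yD; apply; rewrite inE; apply/orP; right.
    move: yy'; rewrite /adj inE => /orP[/(Dcl _ _ yD)|//]; by rewrite (negPf y'D).
  rewrite -(@green_conn _ _ y) //; apply: connect1; apply: Wof => //.
  rewrite notin_touch; apply/subsetP => t; rewrite in_set2 in_setC.
  by case/orP=> /eqP->.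
rewrite inE => /orP[zD|zg].
  have [/negP[]] := D1 z zD; rewrite inE; apply/orP; right.
  by move: zW; rewrite inE => /orP[/(subsetP W1B)/bondB|//]; rewrite cards1.
case: (boolP (z \in D)) => zD.
  have [/negP[]] := D1 z zD; rewrite inE; apply/orP; right.
  by move: zW; rewrite inE => /orP[/(subsetP W1B)/bondB|//]; rewrite cards1.
case/negP: zg; apply/greenP; exists z; rewrite ?connect0 //; apply: Wof => //.
by rewrite notin_touch sub1set inE.
Qed.

(** The law of the union of the two layers once the vertex set [D] of the cluster
    in the first one is known: at [D] only the second layer is still random. *)
Let fD D b : R := 1 - (1 - (if b \in ~: touch D then f1 b else 0)) * (1 - f2 b).

Let fD01 D b : 0 <= fD D b <= 1.
Proof.
rewrite /fD; case: ifP => _; first by rewrite fE.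
by rewrite subr0 mul1r subKr.
Qed.

Let fD_green D v : prob (fD D) (fun W => green (off D W) v) <= m.
Proof.
rewrite -(mE v) -magf_ghost //.
have -> : prob (fD D) (fun W => green (off D W) v) = prob f (fun W => green (off D W) v).
  pose X W : R := (green W v)%:R.
  have offE W : off D W = W :&: ~: touch D by rewrite /off setDE.
  transitivity (expect (fun b => if b \in ~: touch D then f b else 0) X).
    transitivity (expect (fun b => if b \in ~: touch D then fD D b else 0) X).
      by rewrite -expect_restrict; apply: eq_expect => W; rewrite /X offE.
    apply: eq_bigr => W _; congr (_ * _); apply: eq_bigr => b _.
    have E : (if b \in ~: touch D then fD D b else 0) = (if b \in ~: touch D then f b else 0).
      by case: ifP => // bD; rewrite /fD bD fE.
    by rewrite /= E.
  by rewrite -expect_restrict; apply: eq_expect => W; rewrite /X offE.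
by apply: prob_le => // W; apply/green_sub/off_sub.
Qed.

Let gate_ge D u v : u \in D -> v \notin D ->
  (if adj B u v then 1 - s * m else 1) <= expect (fD D) (fun W => gate D W u v).
Proof.
move=> uD vD; have uvD : [set u; v] \in touch D by apply: (@mem_touch _ _ _ u); rewrite // !inE eqxx.
have fDuv : fD D [set u; v] = if adj B u v then s else 0.
  rewrite /fD inE uvD /= subr0 mul1r subKr /f2 /ghost /adj; case: ifP => // _.
  rewrite /vertex_law cards2.
  by have -> : u != v by apply: contraNneq vD => <-.
have -> : expect (fD D) (fun W => gate D W u v) =
    1 - fD D [set u; v] * prob (fD D) (fun W => green (off D W) v).
  rewrite -(expect_mem (fD D)) /prob -[X in _ = X - _](expect_const (fD D)).
  rewrite -(@expect_indep _ _ _ [:: [set u; v]]) -?expectB.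
  - apply: eq_expect => W; rewrite /gate -natrM mulnb; case: (_ && _); by rewrite ?subrr ?subr0.
  - by move=> W W' WW; rewrite (WW _ (mem_head _ _)).
  - move=> W W' WW; congr (green _ v)%:R; apply/setP => b; rewrite !inE.
    case: (boolP (b :&: D == set0)) => //= bD; apply: WW.
    by rewrite inE; apply: contraTneq uvD => <-; rewrite inE bD.
rewrite fDuv; case: ifP => _; last by rewrite mul0r subr0.
by rewrite lerB // ler_wpM2l ?fD_green //; case/andP: s01.
Qed.

Let m01 : 0 <= m <= 1.
Proof. by rewrite -(mE o) -magf_ghost // prob_ge0 ?prob_le1. Qed.

Let sm01 : 0 <= 1 - s * m <= 1.
Proof.
case/andP: m01 => m0 m1; case/andP: s01 => s0 s1.
by rewrite subr_ge0 mulr_ile1 //= gerBl mulr_ge0.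
Qed.

Let shut_ge D : ((1 - g) * (1 - s * m) ^+ Omega) ^+ #|D| <= expect (fD D) (shut D).
Proof.
have/andP[sm0 sm1] := sm01.
have g0 : 0 <= 1 - g by rewrite subr_ge0; case/andP: g01.
have gate_ge0 W u v : 0 <= gate D W u v by rewrite ler0n.
have not_dec u : decreasing (fun W : {set {set T}} => ([set u] \notin W)%:R : R).
  move=> W W' WW; rewrite ler_nat; case: (boolP ([set u] \in W)) => uW.
    by rewrite (subsetP WW _ uW).
  by case: (_ \notin _).
have gates_dec u : decreasing (fun W => \prod_(v in ~: D) gate D W u v).
  by move=> W W' WW; apply: ler_prod => v _; rewrite gate_ge0; apply: gate_dec.
rewrite -prodr_const; apply: le_trans (harris_prod (fD01 D) _ _ _ _); last 2 first.
- move=> u W W' WW; apply: ler_pM; rewrite ?prodr_ge0 //; last exact: gates_dec.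
  exact: not_dec.
- by move=> u W; rewrite mulr_ge0 ?prodr_ge0.
apply: ler_prod => u uD; rewrite mulr_ge0 ?exprn_ge0 //=.
apply: le_trans (harris (fD01 D) (not_dec u) (gates_dec u)).
apply: ler_pM; rewrite ?exprn_ge0 //.
  have -> : expect (fD D) (fun W => ([set u] \notin W)%:R) = 1 - fD D [set u].
    rewrite -(expect_mem (fD D)) -[X in _ = X - _](expect_const (fD D)) -expectB.
    by apply: eq_expect => W; case: (_ \in W); rewrite ?subrr ?subr0.
  rewrite /fD inE (@mem_touch _ D [set u] u) ?inE //= subr0 mul1r subKr /f2 /ghost.
  case: ifP => [/bondB|_]; first by rewrite cards1.
  by rewrite /vertex_law cards1.
apply: le_trans (harris_prod (fD01 D) _ _ _ _) => [|v|v W //]; last exact: gate_dec.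
apply: (@le_trans _ _ (\prod_(v in ~: D) (if adj B u v then 1 - s * m else 1))); last first.
  apply: ler_prod => v; rewrite in_setC => vD; rewrite gate_ge // andbT.
  by case: ifP.
rewrite -big_mkcondr prodr_const -(degB u) /degree.
apply: ler_wiXn2l => //; apply: subset_leq_card.
by apply/subsetP => v; rewrite !inE => /andP[].
Qed.

(** Given the cluster in the first layer, all the events that would connect it to
    green vertices are increasing, so by Harris' inequality they are avoided
    simultaneously with at least the product of the probabilities. *)
Lemma sprinkle x :
  Eperc B q (fun w => ((1 - g) * (1 - s * mag B p g o) ^+ Omega) ^+ #|cluster w x|)
  <= 1 - mag B p g x.
Proof.
rewrite -/m.
pose Y D W1 : R := expect f2 (fun W2 => shut D (W1 :|: W2)).
have -> : 1 - mag B p g x = expect f1 (fun W1 => expect f2 (fun W2 => (~~ green (W1 :|: W2) x)%:R)).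
  rewrite (expect_layers f1 f2 (fun W => (~~ green W x)%:R)) -magf_ghost // -[X in X - _](expect_const f) -expectB.
  apply: eq_bigr => W _; congr (_ * _); first by apply: eq_bigr => b _; rewrite fE.
  by case: (green W x); rewrite ?subrr ?subr0.
apply: (@le_trans _ _ (expect f1 (fun W1 => 1 * Y (reach [set x] W1) (off (reach [set x] W1) W1)))).
  rewrite explore_sum // Eperc_expect -/f1.
  apply: (@le_trans _ _ (\sum_D expect f1 (fun W => 1 * (reach [set x] W == D)%:R) *
      ((1 - g) * (1 - s * m) ^+ Omega) ^+ #|D|)).
    rewrite le_eqVlt; apply/orP; left; apply/eqP.
    rewrite -(explore_total f1 [set x]); apply: eq_bigr => D _; rewrite -expectZr.
    apply: eq_expect => W; case: eqP => [<-|_]; last by rewrite !mulr0 mul0r.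
    by rewrite mul1r mulrC reach1.
  apply: ler_sum => D _; rewrite ler_wpM2l //.
    by apply: expect_ge0 => // W; rewrite mul1r.
  apply: le_trans (shut_ge D) _.
  rewrite /fD -(expect_layers _ f2 (shut D)) -(expect_restrict f1 (~: touch D) (Y D)).
  by rewrite le_eqVlt; apply/orP; left; apply/eqP; apply: eq_expect => W; rewrite /off setDE.
have -> : expect f1 (fun W1 => 1 * Y (reach [set x] W1) (off (reach [set x] W1) W1)) =
    expect f1 (fun W1 => if W1 \subset B
      then Y (cluster W1 x) (off (cluster W1 x) W1) else 0).
  by apply: expect_supp => W1 /supp_bond->; rewrite mul1r reach1.
have -> : expect f1 (fun W1 => expect f2 (fun W2 => (~~ green (W1 :|: W2) x)%:R)) =
    expect f1 (fun W1 => if W1 \subset B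
      then expect f2 (fun W2 => (~~ green (W1 :|: W2) x)%:R) else 0).
  by apply: expect_supp => W1 /supp_bond->.
apply: expect_le => // W1; case: ifP => // W1B.
by apply: expect_le => // W2; apply: shut_le.
Qed.

Lemma mag_sprinkle : g + Omega%:R * (s * mag B p g o) <= 1 ->
  mag B p g o <= mag B q (g + Omega%:R * (s * mag B p g o)) o.
Proof.
rewrite -/m.
set h := g + _ => h1; have/andP[sm0 sm1] := sm01.
have g0 : 0 <= 1 - g by rewrite subr_ge0; case/andP: g01.
have bern : 1 - h <= (1 - g) * (1 - s * m) ^+ Omega.
  have sm : 0 <= s * m by rewrite -[s * m](subKr 1) subr_ge0.
  have B1 k : 1 - k%:R * (s * m) <= (1 - s * m) ^+ k.
    elim: k => [|k IHk]; first by rewrite mul0r subr0.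
    have := ler_wpM2l sm0 IHk; rewrite exprS -natr1; apply: le_trans.
    have : 0 <= k%:R * (s * m) * (s * m) by apply: mulr_ge0 => //; apply: mulr_ge0.
    by lra.
  apply: le_trans (ler_wpM2l g0 (B1 Omega)).
  have : 0 <= g * (Omega%:R * (s * m)).
    by apply: mulr_ge0; [case/andP: g01 | apply: mulr_ge0 => //; exact: ler0n].
  by rewrite /h; lra.
have := sprinkle o; rewrite -/m lerBrDl -lerBrDr => H; apply: le_trans H _.
rewrite /mag !Eperc_expect -[X in X - _](expect_const (bond_law B q)) -expectB.
apply: expect_le => [|w]; first exact: bond_law01.
rewrite lerB // lerXn2r // nnegrE ?subr_ge0 //.
by rewrite mulr_ge0 ?exprn_ge0.
Qed.

End Extrapolation.

(** * From the magnetization to cluster sizes *)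

Section PowerBounds.
Variable R : realFieldType.
Implicit Types (g : R) (n k : nat).

Lemma pow_hyperbola g n : 0 <= g <= 1 -> (1 - g) ^+ n * (1 + n%:R * g) <= 1.
Proof.
move=> /andP[g0 g1]; elim: n => [|n IHn]; first by rewrite mul0r addr0 mulr1.
apply: le_trans IHn; rewrite exprSr -mulrA ler_wpM2l ?exprn_ge0 ?subr_ge0 //.
have n0 : 0 <= n%:R :> R by [].
have : 0 <= n%:R * (g * g) by rewrite !mulr_ge0.
have : 0 <= g * g by rewrite mulr_ge0.
by rewrite -natr1; lra.
Qed.

Lemma pow_ge g n : 0 <= g <= 1 -> 1 - (1 - g) ^+ n <= n%:R * g.
Proof.
move=> /andP[g0 g1]; elim: n => [|n IHn]; first by rewrite subrr mul0r.
rewrite exprS -natr1.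
have : (1 - g) ^+ n <= 1 by rewrite exprn_ile1 ?subr_ge0 ?gerBl.
by move/(ler_wpM2l g0); move: IHn; move: ((1 - g) ^+ n) => Q; lra.
Qed.

Lemma truncated_size_le g n k : 0 <= g <= 1 ->
  (minn n k)%:R * g <= (1 + k%:R * g) * (1 - (1 - g) ^+ n).
Proof.
move=> g01; have /andP[g0 g1] := g01.
have Q1 : (1 - g) ^+ n <= 1 by rewrite exprn_ile1 ?subr_ge0 ?gerBl.
have k0 j : 0 <= j%:R * g by rewrite mulr_ge0.
have [nk|kn] := leqP n k.
  apply: (@le_trans _ _ ((1 + n%:R * g) * (1 - (1 - g) ^+ n))).
    by have := pow_hyperbola n g01; move: ((1 - g) ^+ n) => Q; lra.
  by rewrite ler_wpM2r ?subr_ge0 // lerD2l ler_wpM2r // ler_nat.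
have Qk : (1 - g) ^+ n <= (1 - g) ^+ k.
  by apply: ler_wiXn2l; rewrite ?subr_ge0 ?gerBl // ltnW.
have kg : 0 <= 1 + k%:R * g by rewrite addr_ge0.
have := ler_wpM2l kg Qk; have := pow_hyperbola k g01.
by move: ((1 - g) ^+ n) ((1 - g) ^+ k) => Q Q'; lra.
Qed.

End PowerBounds.

Section LargestCluster.
Local Open Scope nat_scope.
Variable T : finType.
Implicit Types (W : {set {set T}}) (x : T).

Lemma cluster_same W x y : y \in cluster W x -> cluster W y = cluster W x.
Proof.
rewrite mem_cluster => xy; apply/setP => z; rewrite !mem_cluster.
apply/idP/idP; first exact: connect_trans.
by apply: connect_trans; rewrite conn_sym.
Qed.

Lemma Cmax_witness W (o : T) : exists x, Cmax W = #|cluster W x|.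
Proof.
have T0 : (0 < #|T|)%N by apply/card_gt0P; exists o.
by have [x xE] := @bigop.eq_bigmax T (fun x => #|cluster W x|) T0; exists x.
Qed.

Lemma Cmax_count W (o : T) k : (Cmax W <= k + \sum_x (k <= #|cluster W x|))%N.
Proof.
have [x ->] := Cmax_witness W o; have [|kx] := leqP #|cluster W x| k; first by move/leq_trans; apply; exact: leq_addr.
apply: leq_trans (leq_addl _ _); rewrite -sum1_card big_mkcond /=.
apply: leq_sum => y _; case: ifP => // /cluster_same->; by rewrite (ltnW kx).
Qed.

Lemma Cmax_sqr W (o : T) : (Cmax W ^ 2 <= \sum_x #|cluster W x|)%N.
Proof.
have [x ->] := Cmax_witness W o.
have -> : (#|cluster W x| ^ 2 = \sum_(y in cluster W x) #|cluster W y|)%N.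
  rewrite (eq_bigr (fun=> #|cluster W x|)) => [|y /cluster_same-> //].
  by rewrite sum_nat_const -mulnn.
by rewrite [leqRHS](bigID (mem (cluster W x))) /= leq_addr.
Qed.

Lemma Cmax_le_card W : (Cmax W <= #|T|)%N.
Proof. by apply/bigmax_leqP => x _; apply: max_card. Qed.

Lemma Cmax_sub W W' : W \subset W' -> (Cmax W <= Cmax W')%N.
Proof.
move=> WW; apply/bigmax_leqP => x _; apply: leq_trans (leq_bigmax x).
exact/subset_leq_card/cluster_sub.
Qed.

Lemma sum_leq_ord (V b : nat) : (\sum_(j < V) (j < b) = minn V b)%N.
Proof.
elim: V => [|V IHV]; first by rewrite big_ord0 min0n.
by rewrite big_ord_recr /= IHV; lia.
Qed.

End LargestCluster.

Section ClusterSize.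
Variables (R : realType) (T : finType) (B : {set {set T}}) (o : T).
Hypotheses (bondB : is_bond_set B) (transB : transitive_graph B).
Variables (p : R).
Hypothesis p01 : 0 <= p <= 1.
Implicit Types (W w : {set {set T}}) (x y : T) (g : R).

Let V : R := #|T|%:R.
Let f01 : forall b, 0 <= bond_law B p b <= 1. Proof. exact: bond_law01. Qed.

Definition tail k : R := Pperc B p (fun w => (k <= #|cluster w o|)%N).

Definition ECmax : R := Eperc B p (fun w => (Cmax w)%:R).

Lemma mag_le_chi g : 0 <= g <= 1 -> mag B p g o <= g * chi B o p.
Proof.
move=> g01; rewrite /mag /chi !Eperc_expect -expectZ; apply: expect_le => // w.
by rewrite mulrC pow_ge.
Qed.

Lemma mag_ge0 g : 0 <= g <= 1 -> 0 <= mag B p g o.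
Proof. by move=> g01; rewrite -magf_ghost //; apply/magf_ge0/ghost01. Qed.

Lemma mag_le1 g : 0 <= g <= 1 -> mag B p g o <= 1.
Proof. by move=> g01; rewrite -magf_ghost //; apply/prob_le1/ghost01. Qed.

Lemma chi_le_card : chi B o p <= V.
Proof.
rewrite /chi Eperc_expect -[leRHS](expect_const (bond_law B p)).
by apply: expect_le => // w; rewrite ler_nat max_card.
Qed.

Lemma chi_ge1 : 1 <= chi B o p.
Proof.
rewrite /chi Eperc_expect -[leLHS](expect_const (bond_law B p)).
apply: expect_le => // w; rewrite ler1n card_gt0; apply/set0Pn; exists o.
exact: cluster_refl.
Qed.

Lemma ECmax_le_card : ECmax <= V.
Proof.
rewrite /ECmax Eperc_expect -[leRHS](expect_const (bond_law B p)).
by apply: expect_le => // w; rewrite ler_nat Cmax_le_card.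
Qed.

Lemma ECmax_ge0 : 0 <= ECmax.
Proof. by rewrite /ECmax Eperc_expect; apply: expect_ge0. Qed.

Lemma tail_ge0 k : 0 <= tail k.
Proof. by rewrite /tail Pperc_expect; apply: prob_ge0. Qed.

(** The slope of the magnetization at zero is the expected cluster size. *)
Lemma chi_le_slope K : (forall g, 0 < g -> g <= 1 -> mag B p g o <= g * K) -> chi B o p <= K.
Proof.
move=> slope; rewrite leNgt; apply/negP => Kchi.
have V1 : 1 <= V by rewrite /V ler1n; apply/card_gt0P; exists o.
have V2 : 0 < V ^+ 2 by rewrite exprn_gt0 //; lra.
have lower g : 0 < g -> g <= 1 -> g * chi B o p - g ^+ 2 * V ^+ 2 <= mag B p g o.
  move=> g0 g1; rewrite /mag /chi !Eperc_expect -expectZ.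
  rewrite -[X in _ - X](expect_const (bond_law B p)) -expectB; apply: expect_le => // w.
  set n := #|cluster w o|; have nV : n%:R <= V by rewrite ler_nat max_card.
  have g01 : 0 <= g <= 1 by rewrite (ltW g0).
  have := pow_hyperbola n g01; have ng : 0 <= n%:R * g by rewrite mulr_ge0 // ltW.
  have : (n%:R * g) ^+ 2 <= g ^+ 2 * V ^+ 2.
    by rewrite exprMn mulrC ler_wpM2l ?exprn_ge0 ?(ltW g0) // lerXn2r ?nnegrE // ler0n.
  have : 0 <= (1 - g) ^+ n by rewrite exprn_ge0 ?subr_ge0.
  move: (g ^+ 2 * _) ((1 - g) ^+ n) ng => S Q; rewrite [g * _]mulrC.
  move: (n%:R * g) => y y0 Q0 yS Qy.
  suff : Q <= 1 - y + y ^+ 2 by lra.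
  have : Q * (1 + y) <= (1 - y + y ^+ 2) * (1 + y).
    by apply: le_trans Qy _; have := exprn_ge0 3 y0; rewrite exprS; lra.
  by rewrite ler_pM2r //; lra.
pose e := chi B o p - K; have e0 : 0 < e by rewrite subr_gt0.
pose g := e / (e + 2 * V ^+ 2).
have d0 : 0 < e + 2 * V ^+ 2 by lra.
have g0 : 0 < g by rewrite divr_gt0.
have g1 : g <= 1 by rewrite ler_pdivrMr // mul1r; lra.
have := le_trans (lower g g0 g1) (slope g g0 g1).
have -> : g ^+ 2 * V ^+ 2 = g * (g * V ^+ 2) by ring.
have gV : g * V ^+ 2 < e.
  by rewrite mulrAC ltr_pdivrMr // ltr_pM2l //; lra.
have := ltr_pM2l g0 (g * V ^+ 2) e; rewrite gV; rewrite /e; lra.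
Qed.

Lemma tail_le_mag g k : 0 <= g <= 1 ->
  tail k * (k%:R * g) <= (1 + k%:R * g) * mag B p g o.
Proof.
move=> g01; rewrite /tail Pperc_expect /prob /mag Eperc_expect -expectZ -expectZr.
apply: expect_le => // w; have [kn|kn] := leqP k #|cluster w o|.
  by rewrite mul1r; apply: le_trans (truncated_size_le _ k g01); rewrite (minn_idPr kn).
by rewrite mul0r; apply: le_trans (truncated_size_le _ k g01); rewrite mulr_ge0 //; case/andP: g01.
Qed.

Lemma truncated_le_mag g k : 0 <= g <= 1 ->
  Eperc B p (fun w => (minn #|cluster w o| k)%:R) * g <= (1 + k%:R * g) * mag B p g o.
Proof.
move=> g01; rewrite /mag !Eperc_expect -expectZ -expectZr.
by apply: expect_le => // w; apply: truncated_size_le.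
Qed.

Lemma sum_tail k : Eperc B p (fun w => (\sum_x (k <= #|cluster w x|))%:R) = V * tail k.
Proof.
have -> : Eperc B p (fun w => (\sum_x (k <= #|cluster w x|))%:R) =
    \sum_x Eperc B p (fun w => (k <= #|cluster w x|)%:R).
  rewrite Eperc_expect; under [RHS]eq_bigr do rewrite Eperc_expect.
  by rewrite -expect_sum; apply: eq_expect => w; rewrite natr_sum.
rewrite mulr_natl -sumr_const; apply: eq_bigr => x _.
rewrite (Eperc_cluster_size bondB transB p (fun n => (k <= n)%:R) x o).
by rewrite /tail Pperc_expect /prob -Eperc_expect.
Qed.

Lemma ECmax_le k : ECmax <= k%:R + V * tail k.
Proof.
rewrite -sum_tail /ECmax !Eperc_expect -[X in X + _](expect_const (bond_law B p)) -expectD.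
by apply: expect_le => // w; rewrite -natrD ler_nat Cmax_count.
Qed.

(** From [Cmax ^ 2 <= sum_x |C(x)|] and [2 * Cmax <= Cmax ^ 2 / L + L]. *)
Lemma ECmax_sqr L : 0 < L -> ECmax <= (V * chi B o p / L + L) / 2.
Proof.
move=> L0.
have E : V * chi B o p = Eperc B p (fun w => (\sum_x #|cluster w x|)%:R).
  rewrite mulr_natl -sumr_const [RHS]Eperc_expect.
  under [RHS]eq_expect do rewrite natr_sum.
  rewrite expect_sum; apply: eq_bigr => x _; rewrite -Eperc_expect.
  exact: (Eperc_cluster_size bondB transB p (fun n => n%:R)).
rewrite E /ECmax !Eperc_expect -expectZr -[X in _ + X](expect_const (bond_law B p)).
rewrite -expectD -expectZr; apply: expect_le => // w.
have := Cmax_sqr w o; rewrite -(ler_nat R) natrX; move: (Cmax w)%:R (\sum_x _)%:R => c S cS.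
have : 0 <= (c - L) ^+ 2 / L by rewrite divr_ge0 ?sqr_ge0 // ltW.
have : c ^+ 2 / L <= S / L by rewrite ler_pM2r ?invr_gt0.
have -> : (c - L) ^+ 2 / L = c ^+ 2 / L - 2 * c + L by field; rewrite gt_eqF.
lra.
Qed.

Lemma tail_disj k b : tail (k + b.*2) <= tail k * prob (bond_law B p) (fun W => (b <= Cmax W)%N).
Proof.
rewrite /tail !Pperc_expect.
apply: (@le_trans _ _ (prob (bond_law B p)
   (disj (fun W => (k <= #|cluster W o|)%N) (fun W => (b <= Cmax W)%N)))).
  by apply: prob_le => // W; apply: cluster_disj.
apply: bk => // W W' WW; last by move/leq_trans; apply; apply: Cmax_sub.
by move/leq_trans; apply; apply/subset_leq_card/cluster_sub.
Qed.

(** A cluster of size [k + j] contains two disjoint pieces, one of size [k] at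
    [o] and one of size [j / 2] somewhere; summing over [j] the second factor
    yields the expected size of the largest cluster. *)
Lemma chi_le_ECmax k :
  chi B o p <= Eperc B p (fun w => (minn #|cluster w o| k)%:R) + tail k * (1 + 2 * ECmax).
Proof.
have H1 : chi B o p <= Eperc B p (fun w => (minn #|cluster w o| k)%:R)
      + \sum_(j < #|T|) tail (k + j.+1).
  rewrite /chi !Eperc_expect /tail; under [X in _ + X]eq_bigr do rewrite Pperc_expect /prob.
  rewrite -expect_sum -expectD; apply: expect_le => // w.
  rewrite -natr_sum -natrD ler_nat.
  have := max_card (mem (cluster w o)); move: #|cluster w o| => n nT.
  have E : (\sum_(j < #|T|) (k + j.+1 <= n) = \sum_(j < #|T|) (j < n - k))%N.
    by apply: eq_bigr => j _; congr (nat_of_bool _); apply/idP/idP; lia.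
  by rewrite E sum_leq_ord; lia.
apply: le_trans H1 _; rewrite lerD2l.
apply: (@le_trans _ _ (\sum_(j < #|T|) tail k * prob (bond_law B p) (fun W => (j.+1./2 <= Cmax W)%N))).
  apply: ler_sum => j _; apply: le_trans (tail_disj k j.+1./2).
  rewrite /tail !Pperc_expect; apply: prob_le => // W; apply: leq_trans.
  by rewrite leq_add2l; have := odd_double_half j.+1; lia.
rewrite -mulr_sumr ler_wpM2l ?tail_ge0 //.
rewrite /prob -expect_sum /ECmax Eperc_expect -expectZ -[X in X + _](expect_const (bond_law B p)).
rewrite -expectD; apply: expect_le => // W; rewrite -natr_sum -natrM nat1r ler_nat.
apply: (@leq_trans (\sum_(j < #|T|) (j < (2 * Cmax W).+1))%N).
  apply: leq_sum => j _; case: (leqP j.+1./2 (Cmax W)) => // H.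
  by have -> : (j < (2 * Cmax W).+1)%N by have := odd_double_half j.+1; lia.
by rewrite sum_leq_ord geq_minr.
Qed.

End ClusterSize.

(** * Consequences of the triangle condition and the two regimes *)

Section Growth.
Variables (R : realType) (T : finType) (B : {set {set T}}) (o : T) (Omega : nat).
Hypotheses (bondB : is_bond_set B) (transB : transitive_graph B).
Hypothesis degB : forall x, degree B x = Omega.

(** The slope at [g = 0] of [mag_sprinkle]. *)
Lemma chi_growth (q s p : R) : 0 <= q <= 1 -> 0 <= s <= 1 -> 0 <= p <= 1 ->
  1 - p = (1 - q) * (1 - s) ->
  chi B o p * (1 - Omega%:R * s * chi B o q) <= chi B o q.
Proof.
move=> q01 s01 p01 pE; set X := chi B o q.
have X1 : 1 <= X by apply: chi_ge1.
have [Y0|Y0] := lerP (1 - Omega%:R * s * X) 0.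
  apply: (@le_trans _ _ 0); last by lra.
  have p1 := chi_ge1 B o p01.
  rewrite mulr_ge0_le0 //; lra.
rewrite -(ler_pdivlMr _ _ Y0); apply: (chi_le_slope p01) => g g0 g1.
have g01 : 0 <= g <= 1 by rewrite g1 ltW.
rewrite mulrA (ler_pdivlMr _ _ Y0).
have m0 := mag_ge0 o bondB p01 g01; have m1 := mag_le1 o bondB p01 g01.
have s0 : 0 <= Omega%:R * s by rewrite mulr_ge0 //; case/andP: s01.
suff : mag B p g o <= (g + Omega%:R * (s * mag B p g o)) * X by lra.
have h0 : 0 <= g + Omega%:R * (s * mag B p g o) 
  by rewrite mulrA addr_ge0 ?(ltW g0) // mulr_ge0.
have [h1|h1] := lerP (g + Omega%:R * (s * mag B p g o)) 1.
  apply: le_trans (mag_sprinkle bondB transB degB q01 s01 p01 g01 pE h1) _.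
  by apply: mag_le_chi; rewrite // h0.
by apply: le_trans m1 _; rewrite -[leLHS]mulr1; apply: ler_pM; rewrite ?ler01 ?(ltW h1).
Qed.

Lemma chi_zero : chi B o (0 : R) <= 1.
Proof.
rewrite /chi Eperc_expect -[leRHS](expect_const (bond_law B 0)) le_eqVlt; apply/orP; left.
apply/eqP; apply: expect_supp => W W0.
have -> : W = set0.
  by apply/setP => b; rewrite inE; apply/negP => /W0; rewrite /bond_law if_same eqxx.
suff -> : cluster set0 o = [set o] by rewrite cards1.
apply/setP => y; rewrite inE mem_cluster; apply/idP/eqP => [|->]; last exact: connect0.
by case/connectP => -[|z s] //= /andP[]; rewrite /adj inE.
Qed.

(** Growth from the empty configuration: a large susceptibility requires
    [Omega * p] close to [1]. *)
Lemma degree_lower (p : R) : 0 <= p <= 1 -> (1 - Omega%:R * p) * chi B o p <= 1.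
Proof.
move=> p01; have z01 : 0 <= (0 : R) <= 1 by rewrite lexx ler01.
have := chi_growth z01 p01 p01; rewrite subr0 mul1r => /(_ erefl).
have := chi_zero; have := chi_ge1 B o z01 => c1 c2.
have -> : chi B o (0 : R) = 1 by apply/eqP; rewrite eq_le c1 c2.
by rewrite mulr1 mulrC.
Qed.

Section Triangle.
Variables (p a : R).
Hypothesis p01 : 0 <= p <= 1.
Hypothesis triB : forall x y, triangle B p x y <= (x == y)%:R + a.

Let tau_ge0 x y : 0 <= tau B p x y.
Proof. by rewrite /tau Pperc_expect; apply/prob_ge0/bond_law01. Qed.

Let tau_refl x : tau B p x x = 1.
Proof.
rewrite /tau Pperc_expect /prob -[RHS](expect_const (bond_law B p)).
by apply: eq_expect => W; rewrite connect0.
Qed.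

Lemma triangle_bond x y : adj B x y -> p <= a.
Proof.
move=> xy; have xNy : x != y.
  by apply: contraTneq xy => ->; rewrite /adj; apply/negP => /bondB; rewrite setUid cards1.
have := triB x y; rewrite (negPf xNy) add0r; apply: le_trans.
apply: (@le_trans _ _ (tau B p x y)).
  rewrite /tau Pperc_expect.
  have E : expect (bond_law B p) (fun W => ([set x; y] \in W)%:R) = p.
    by rewrite expect_mem /bond_law [_ \in B]xy.
  rewrite -[leLHS]E.
  apply: expect_le => [|W]; first exact: bond_law01.
  rewrite ler_nat; case eW: (_ \in W) => //.
  by have -> : connect (adj W) x y by apply: connect1.
rewrite /triangle (bigD1 x) //= (bigD1 x) //= tau_refl !mul1r -addrA lerDl.
by rewrite addr_ge0 // !sumr_ge0 // => u _; rewrite ?sumr_ge0 // => *; rewrite !mulr_ge0.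
Qed.

Lemma sum_tau x : \sum_y tau B p x y = chi B o p.
Proof.
rewrite /chi -(Eperc_cluster_size bondB transB p (fun n => n%:R) x) Eperc_expect.
under eq_bigr do rewrite /tau Pperc_expect /prob.
rewrite -expect_sum; apply: eq_expect => W; rewrite -natr_sum -sum1_card [in RHS]big_mkcond.
by congr (_%:R); apply: eq_bigr => y _; rewrite mem_cluster; case: (connect _ _ _).
Qed.

Lemma chi_cube : chi B o p ^+ 3 <= 1 + a * #|T|%:R.
Proof.
have -> : chi B o p ^+ 3 = \sum_y triangle B p o y.
  rewrite /triangle exchange_big /=.
  transitivity (\sum_u tau B p o u * chi B o p ^+ 2).
    by rewrite -mulr_suml sum_tau exprS.
  apply: eq_bigr => u _; rewrite exchange_big /=.
  transitivity (\sum_v tau B p o u * tau B p u v * chi B o p).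
    by rewrite -mulr_suml -mulr_sumr sum_tau expr2 mulrA.
  by apply: eq_bigr => v _; rewrite -mulr_sumr sum_tau.
apply: le_trans (ler_sum _ (fun y _ => triB o y)) _.
rewrite big_split /= sumr_const mulr_natr lerD2r (bigD1 o) //= eqxx big1 ?addr0 //.
by move=> y; rewrite eq_sym => /negPf->.
Qed.

End Triangle.

Lemma markov_Cmax (p c d omega : R) : 0 <= p <= 1 -> 0 < d -> 0 < omega ->
  ECmax B p <= c * d -> Pperc B p (fun w => omega * d <= (Cmax w)%:R) <= c / omega.
Proof.
move=> p01 d0 omega0 EC; rewrite ler_pdivlMr // -(ler_pM2r d0) -mulrA; apply: le_trans EC.
rewrite Pperc_expect /prob /ECmax Eperc_expect -expectZr.
apply: expect_le => [|w]; first exact: bond_law01.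
by case: (lerP (omega * d) (Cmax w)%:R); rewrite ?mul1r ?mul0r.
Qed.

End Growth.

Lemma nat_above (R : realType) (x : R) : 0 <= x -> exists k : nat, x < k%:R <= x + 1.
Proof.
move=> x0; have /andP[h1 h2] := truncn_itv x0.
by exists (Num.truncn x).+1; rewrite h2 -natr1 lerD2r.
Qed.

Section Window.
Variables (R : realType) (T : finType) (B : {set {set T}}) (o : T) (Omega : nat).
Hypotheses (bondB : is_bond_set B) (transB : transitive_graph B).
Hypothesis degB : forall x, degree B x = Omega.
Variables (pc p eps L : R).
Hypotheses (pc01 : 0 <= pc <= 1) (p01 : 0 <= p <= 1) (pc_small : pc <= 1 / 1000).
Hypotheses (Om0 : 0 < Omega%:R :> R) (eps0 : 0 <= eps).
Hypothesis pE : p = pc + eps / Omega%:R.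
Hypotheses (L1 : 1 <= L) (VE : #|T|%:R = L ^+ 3).

Let s := (p - pc) / (1 - pc).

Let qc : 0 < 1 - pc.
Proof. by have := pc_small; lra. Qed.

Let pcp : pc <= p.
Proof. by rewrite pE lerDl divr_ge0 // ltW. Qed.

Let s01 : 0 <= s <= 1.
Proof.
rewrite /s; apply/andP; split.
  by apply: divr_ge0; [rewrite subr_ge0 | exact: ltW].
by rewrite (ler_pdivrMr _ _ qc) mul1r lerD2r; case/andP: p01.
Qed.

Let sE : 1 - p = (1 - pc) * (1 - s).
Proof. by rewrite /s mulrBr mulr1 mulrC divfK ?gt_eqF //; ring. Qed.

Let Oms : Omega%:R * s <= eps * (101 / 100).
Proof.
have -> : Omega%:R * s = eps / (1 - pc).
  by rewrite /s pE; field; rewrite !gt_eqF.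
rewrite ler_wpM2l // -[leLHS]mul1r ler_pdivrMr //.
by have := pc_small; lra.
Qed.

Let Oms0 : 0 <= Omega%:R * s.
Proof. by rewrite mulr_ge0 //; case/andP: s01. Qed.

(** The susceptibility at most doubles while [Omega * s * chi(pc) <= 1 / 2]. *)
Lemma inside_window : chi B o pc <= L / 500 -> eps * L <= 100 ->
  chi B o p <= L /\ ECmax B p <= L ^+ 2.
Proof.
move=> X_small epsL; have X1 := chi_ge1 B o pc01.
have half : Omega%:R * s * chi B o pc <= 1 / 2.
  apply: (@le_trans _ _ ((eps * (101 / 100)) * (L / 500))); last by lra.
  by apply: ler_pM => //; lra.
have growth := chi_growth o bondB transB degB pc01 s01 p01 sE.
have chi_small : chi B o p <= L / 250.
  have c1 := chi_ge1 B o p01.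
  have : chi B o p * (1 / 2) <= chi B o p * (1 - Omega%:R * s * chi B o pc).
    by rewrite ler_wpM2l //; lra.
  by lra.
have L0 : 0 < L by have := L1; lra.
split; first by lra.
apply: le_trans (ECmax_sqr o bondB transB p01 (exprn_gt0 2 L0)) _.
rewrite VE; have -> : L ^+ 3 * chi B o p / L ^+ 2 = L * chi B o p by field; rewrite gt_eqF.
have : L * chi B o p <= L * (L / 250) by rewrite ler_wpM2l // ltW.
by have := exprn_ge0 2 (ltW L0); lra.
Qed.

Hypothesis sqrt_law : forall g, 0 <= g <= 1 ->
  (999 / 1000) * ((1 - g) * mag B pc g o ^+ 2) <= 4 * g.

(** The square-root law at [pc] turns [mag_sprinkle] into a quadratic inequality
    for the magnetization at [p], whose positive root is of order [eps]. *)
Let mag_above : 0 < eps -> eps < 1 / 9 -> mag B p (eps ^+ 2 / 10) o <= 47 / 10 * eps.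
Proof.
move=> e0 eps9; pose g := eps ^+ 2 / 10; rewrite -/g.
have e2 : 0 < eps ^+ 2 by rewrite exprn_gt0.
have e2' : eps ^+ 2 <= 1 / 81.
  have -> : 1 / 81 = (1 / 9) ^+ 2 :> R by field.
  by rewrite lerXn2r ?nnegrE //; lra.
have g0 : 0 < g by rewrite /g; lra.
have g01 : 0 <= g <= 1 by rewrite (ltW g0) /g /=; lra.
pose m := mag B p g o; rewrite -/m.
have m0 : 0 <= m by apply: mag_ge0.
have m1 : m <= 1 by apply: mag_le1.
pose h := g + Omega%:R * (s * m).
have hE : h <= g + eps * (101 / 100) * m by rewrite lerD2l mulrA ler_wpM2r // Oms.
have em : eps * m <= 1 / 9 by rewrite -[leRHS]mulr1; apply: ler_pM => //; exact: ltW.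
have h_small : h <= 23 / 200 by move: hE; rewrite /g; lra.
have h0 : 0 <= h by rewrite addr_ge0 ?(ltW g0) // mulrA mulr_ge0.
have mh : m <= mag B pc h o.
  by apply: mag_sprinkle p01 g01 sE _ => //; rewrite -/m -/h; lra.
have h01 : 0 <= h <= 1 by rewrite h0; lra.
have H1 : m ^+ 2 * (177 / 200) <= (1 - h) * mag B pc h o ^+ 2.
  rewrite mulrC; apply: ler_pM; rewrite ?exprn_ge0 //.
  - by move: h_small; lra.
  - by move: h_small; lra.
  - by rewrite lerXn2r ?nnegrE //; exact: le_trans mh.
have quad : 884 / 1000 * m ^+ 2 <= 4 / 10 * eps ^+ 2 + 404 / 100 * (eps * m).
  by have := sqrt_law h01; move: hE H1; rewrite /g; lra.
rewrite leNgt; apply/negP => big.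
(* The larger root of the quadratic form in [m] lies below [47 / 10 * eps]. *)
have P : 0 < (m - 47 / 10 * eps) * (884 / 1000 * m + 1 / 10 * eps).
  by apply: mulr_gt0; [rewrite subr_gt0 | move: m0 e0; lra].
have em0 : 0 <= eps * m by apply: mulr_ge0.
by move: quad P em0 e2; rewrite !expr2; lra.
Qed.

Let volume : 100 <= eps * L ->
  10 ^+ 6 <= eps ^+ 3 * #|T|%:R /\ 100 <= eps * #|T|%:R.
Proof.
move=> epsL; have L0 : 0 <= L by have := L1; lra.
split.
  rewrite VE -exprMn; have -> : 10 ^+ 6 = 100 ^+ 3 :> R by ring.
  by rewrite lerXn2r ?nnegrE // mulr_ge0.
apply: le_trans epsL _; rewrite ler_wpM2l // VE exprS ler_peMr //.
by rewrite exprn_ege1.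
Qed.

(** With [g = eps ^ 2 / 10] and [k] a large multiple of [1 / g], a cluster of size
    [k] is green with probability close to [1], while [k] is far below the volume
    scale [eps * #|T|] because [eps] is large compared with [1 / L]. *)
Lemma above_window : 100 <= eps * L -> eps < 1 / 9 ->
  ECmax B p <= 5 * eps * #|T|%:R /\ chi B o p <= 50 * (eps ^+ 2 * #|T|%:R).
Proof.
move=> epsL eps9; have [e3V eV] := volume epsL.
have e0 : 0 < eps.
  by rewrite lt_neqAle eps0 andbT; apply: contraTneq epsL => <-; rewrite mul0r -ltNge.
have := mag_above e0 eps9; pose g := eps ^+ 2 / 10; rewrite -/g; set m := mag _ _ _ _ => m_le.
have e2 : 0 < eps ^+ 2 by rewrite exprn_gt0.
have g0 : 0 < g by rewrite divr_gt0.
have g1 : g <= 1.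
  rewrite /g ler_pdivrMr // mul1r; apply: (@le_trans _ _ 1); last by rewrite ler1n.
  by rewrite exprn_ile1 //; move: eps9; lra.
have g01 : 0 <= g <= 1 by rewrite g1 ltW.
have V0 : 0 <= #|T|%:R :> R by rewrite ler0n.
have [k /andP[k1 k2]] := nat_above (divr_ge0 (ler0n R 40) (ltW g0)).
have kg1 : 40 < k%:R * g by rewrite -ltr_pdivrMr.
have kg2 : k%:R * g <= 41.
  have := ler_wpM2r (ltW g0) k2; rewrite mulrDl divfK ?gt_eqF //.
  by move: g1; lra.
have th : tail B o p k <= 482 / 100 * eps.
  have := tail_le_mag B o p01 k g01; rewrite -/m.
  have := tail_ge0 B o p01 k; have : 0 <= m by apply: mag_ge0.
  move: (k%:R * g) kg1 kg2 m_le; move: (tail _ _ _ _) => t x x1 x2 m_le m0 t0 H.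
  have : t * x <= (41 / 40 * m) * x.
    by apply: le_trans H _; rewrite mulrAC ler_wpM2r //; lra.
  by rewrite ler_pM2r; lra.
have k_le : k%:R <= 1 / 1000 * (eps * #|T|%:R).
  rewrite -(ler_pM2r e2).
  have -> : 1 / 1000 * (eps * #|T|%:R) * eps ^+ 2 = 1 / 1000 * (eps ^+ 3 * #|T|%:R) by ring.
  by move: kg2 e3V; rewrite /g; lra.
have EC : ECmax B p <= 483 / 100 * (eps * #|T|%:R).
  apply: le_trans (ECmax_le o bondB transB p01 k) _.
  by have := ler_wpM2l V0 th; move: k_le; lra.
have Emin : Eperc B p (fun w => (minn #|cluster w o| k)%:R) <= 2 / 1000 * (eps ^+ 2 * #|T|%:R).
  have := truncated_le_mag B o p01 k g01; rewrite -/m; set E := Eperc _ _ _ => H.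
  have H2 : E * g <= 42 * (47 / 10 * eps).
    apply: le_trans H _; apply: ler_pM => //; last by move: kg2; lra.
      by move: kg1; lra.
    by apply: mag_ge0.
  rewrite -(ler_pM2r (mulr_gt0 g0 e0)) mulrA.
  have := ler_wpM2r (ltW e0) H2.
  have -> : 2 / 1000 * (eps ^+ 2 * #|T|%:R) * (g * eps) = 2 / 10000 * eps ^+ 2 * (eps ^+ 3 * #|T|%:R).
    by rewrite /g; field.
  by have := ler_wpM2l (ltW e2) e3V; lra.
split.
  by have := mulr_ge0 (ltW e0) V0; move: EC; lra.
apply: le_trans (chi_le_ECmax B o p01 k) _.
have H : tail B o p k * (1 + 2 * ECmax B p)
    <= (482 / 100 * eps) * (1 + 2 * (483 / 100 * (eps * #|T|%:R))).
  apply: ler_pM; rewrite ?tail_ge0 //; last by move: EC; lra.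
  by have := ECmax_ge0 B p01; lra.
have eeV := ler_wpM2l (ltW e0) eV; have eeV0 := mulr_ge0 (ltW e2) V0.
by move: H Emin eeV eeV0; rewrite !expr2; lra.
Qed.

Lemma cluster_bounds : chi B o pc <= L / 500 ->
  ECmax B p <= 21 * eps * #|T|%:R + 7 * L ^+ 2 /\
  chi B o p <= 81 * (L + eps ^+ 2 * #|T|%:R).
Proof.
move=> X_small; have V0 : 0 <= #|T|%:R :> R by rewrite ler0n.
have L0 : 0 <= L by apply: le_trans L1.
have eV := mulr_ge0 eps0 V0; have e2V := mulr_ge0 (exprn_ge0 2 eps0) V0.
have L2 := exprn_ge0 2 L0.
have [epsL|/ltW epsL] := lerP (eps * L) 100.
  by have [] := inside_window X_small epsL; split; lra.
(* For [eps >= 1 / 9] the claims follow from [Cmax <= V] and [chi <= V]. *)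
have [e9|e9] := ltrP eps (1 / 9).
  by have [] := above_window epsL e9; split; lra.
have EV := ECmax_le_card B p01; have CV := chi_le_card B o p01.
have e2 : (1 / 9) ^+ 2 <= eps ^+ 2 by rewrite lerXn2r ?nnegrE ?divr_ge0.
have H1 := ler_wpM2r V0 e9; have H2 := ler_wpM2r V0 e2.
split; first by move: EV H1 L2 eV; lra.
have E : (1 / 9) ^+ 2 = 1 / 81 :> R by field.
by move: H2 CV L0; rewrite E; lra.
Qed.

End Window.

(** * Choice of the constants *)

Lemma connected_bond (T : finType) (B : {set {set T}}) (o : T) :
  connected_graph B -> (1 < #|T|)%N -> exists x, adj B o x.
Proof.
move=> conB T1; have : (0 < #|[set: T] :\ o|)%N.
  by have := cardsD1 o [set: T]; rewrite cardsT inE; lia.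
case/card_gt0P=> y; rewrite !inE andbT => yo.
case/connectP: (conB o y) yo => -[|x s] /=; first by move=> _ ->; rewrite eqxx.
by case/andP=> ox _ _ _; exists x.
Qed.

(** Here [X] stands for the critical susceptibility, and [N] for the inverse of the
    bound [b] on the excess of the triangle diagram. *)
Section Arithmetic.
Variables (R : realFieldType) (b N X : R).
Hypotheses (b0 : 0 < b) (bN : b * N = 1) (NX : N <= X).

Lemma critical_chi_arith (L a : R) : 2 <= N -> (L / 500) ^+ 3 = 8 * (b * L ^+ 3) ->
  0 <= L -> a <= b -> X ^+ 3 <= 1 + a * L ^+ 3 -> X <= L / 500.
Proof.
move=> N2 cube500 L0 ab cube; have NX' := NX; rewrite leNgt; apply/negP => big.
have H1 : 8 * (b * L ^+ 3) < X ^+ 3.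
  by rewrite -cube500 ltrXn2r // ?nnegrE ?divr_ge0 //; lra.
have H2 : a * L ^+ 3 <= b * L ^+ 3 by rewrite ler_wpM2r // exprn_ge0.
have H3 : X <= X ^+ 3 by rewrite exprS ler_peMr ?exprn_ege1 //; lra.
move: N2 NX' H1 H2 H3 cube; move: (X ^+ 3) (a * L ^+ 3) (b * L ^+ 3) => x y z.
by clear => *; lra.
Qed.

Lemma critical_degree_arith (Om q : R) : 0 <= Om -> 0 <= q -> q <= b -> b <= 1 / 100 / 100 ->
  (1 - Om * q) * X <= 1 -> 1 - b <= Om * q /\ 1 - 3 * b <= q ^+ 2 * (Om * (Om - 1)).
Proof.
move=> Om0 q0 qb b_small XO; have b0' := b0.
have N0 : 0 < N by rewrite -(pmulr_rgt0 _ b0) bN ltr01.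
have X0 : 0 < X by apply: lt_le_trans NX.
have OmE : 1 - b <= Om * q.
  rewrite leNgt; apply/negP => H.
  have H1 : b * X < (1 - Om * q) * X by rewrite ltr_pM2r //; lra.
  have H2 : 1 <= b * X by rewrite -bN ler_wpM2l // ltW.
  by have := lt_le_trans (le_lt_trans H2 H1) XO; rewrite ltxx.
split=> //; have -> : q ^+ 2 * (Om * (Om - 1)) = (Om * q) * (Om * q - q) by ring.
apply: (@le_trans _ _ ((1 - b) * (1 - 2 * b))); last by apply: ler_pM; lra.
have bb : 0 <= b * b by rewrite mulr_ge0 // ltW.
by lra.
Qed.

End Arithmetic.

Lemma sqrt_constant_arith (R : realFieldType) (kappa a b : R) : 0 <= a -> a <= b ->
  b <= 1 / 100 / 100 -> 1 - 3 * b <= kappa ->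
  [/\ 5 * a < 1, 0 < kappa & 999 / 1000 <= kappa * (1 - 5 * a)].
Proof.
move=> a0 ab b_small bk.
split; [lra | lra |]; have a1 : 0 <= 1 - 5 * a by lra.
have H := ler_wpM2r a1 bk; have ba : 0 <= b * a by rewrite mulr_ge0 // (le_trans a0).
by lra.
Qed.

Theorem theorem1p4 (R : realType) :
  exists2 b0 : R, 0 < b0 &
  forall lambda : R, 0 < lambda ->
  forall (T : finType) (B : {set {set T}}) (o : T) (Omega : nat),
    is_bond_set B ->
    connected_graph B ->
    transitive_graph B ->
    (forall x : T, degree B x = Omega) ->
  let V : R := #|T|%:R in
    1 < lambda * V `^ (1 / 3) < V ->
  forall pc : R, is_critical_threshold B o lambda pc ->
  forall a0 : R, a0 <= b0 ->
    (forall x y : T, triangle B pc x y <= (x == y)%:R + a0) ->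
    b0^-1 <= lambda * V `^ (1 / 3) ->
  forall eps : R, 0 <= eps ->
  let p : R := pc + eps * (Omega%:R)^-1 in
    0 <= p <= 1 ->
  [/\ Eperc B p (fun w => (Cmax w)%:R) <= 21 * eps * V + 7 * V `^ (2 / 3),
      forall omega : R, 0 < omega ->
        Pperc B p (fun w => omega * (V `^ (2 / 3) + eps * V) <= (Cmax w)%:R)
          <= 21 / omega
    & chi B o p <= 81 * (V `^ (1 / 3) + eps ^+ 2 * V)].
Proof.
(* With this value [chi pc <= L / 500], which leaves room to double the
   susceptibility as long as [eps * L <= 100]. *)
exists (1000 ^+ 3)^-1; first by rewrite invr_gt0 exprn_gt0.
move=> lambda lambda0 T B o Omega bondB conB transB degB V XV pc [pc01 XE] a0 a0_le triB.
rewrite invrK; set L := V `^ (1 / 3) in XV XE *; set X := lambda * L in XV XE *.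
move=> X_large eps eps0 p p01.
have V0 : 0 <= V by rewrite ler0n.
have VE : V = L ^+ 3.
  by rewrite /L -powR_mulrn ?powR_ge0 // -powRrM divfK ?pnatr_eq0 ?powRr1.
have V23 : V `^ (2 / 3) = L ^+ 2.
  by rewrite /L -powR_mulrn ?powR_ge0 // -powRrM; congr (_ `^ _); field.
have V1 : 1 < V by case/andP: XV; apply: lt_trans.
have L0 : 0 <= L by apply: powR_ge0.
have L1 : 1 <= L.
  rewrite leNgt; apply/negP => L1; move: V1; rewrite VE ltNge => /negP; apply.
  by rewrite exprn_ile1 // ltW.
have [x ox] : exists x, adj B o x by apply: connected_bond => //; rewrite -(ltr_nat R).
have bN : (1000 ^+ 3)^-1 * 1000 ^+ 3 = 1 :> R by rewrite mulVf // gt_eqF // exprn_gt0.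
have b_small : (1000 ^+ 3)^-1 <= 1 / 100 / 100 :> R.
  rewrite -exprVn !exprS expr0 mulr1; set c : R := 1000^-1.
  have cE : c = 1 / 1000 by rewrite mul1r.
  by rewrite cE; lra.
have cube500 : (L / 500) ^+ 3 = 8 * ((1000 ^+ 3)^-1 * L ^+ 3).
  have -> : L / 500 = 2 * (1000^-1 * L) by field.
  by rewrite 2!exprMn exprVn; congr (_ * _); ring.
have b0 : 0 < (1000 ^+ 3)^-1 :> R by rewrite invr_gt0 exprn_gt0.
have pc_a := triangle_bond bondB pc01 triB ox.
have pcO : (1 - Omega%:R * pc) * X <= 1 by rewrite -XE; apply: degree_lower.
have cube : X ^+ 3 <= 1 + a0 * L ^+ 3 by rewrite -XE -VE; apply: chi_cube.
have N2 : 2 <= 1000 ^+ 3 :> R.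
  by apply: (@le_trans _ _ 1000); rewrite ?ler_eXnr ?ler_nat ?ler1n.
move: a0_le bN b_small cube500 X_large b0 N2; move: (1000 ^+ 3)^-1 => b; move: (1000 ^+ 3) => N a0_le bN b_small cube500 X_large b0 N2.
have [pcO' kappa_ge] := critical_degree_arith b0 bN X_large (ler0n _ Omega)
  (proj1 (andP pc01)) (le_trans pc_a a0_le) b_small pcO.
have Om0 : 0 < Omega%:R :> R.
  rewrite lt_neqAle ler0n andbT; apply: contraTneq pcO' => <-.
  by rewrite mul0r -ltNge subr_gt0 (le_lt_trans b_small) //; lra.
have X_small : chi B o pc <= L / 500.
  by rewrite XE; apply: (critical_chi_arith X_large N2 cube500 L0 a0_le cube).
have a00 : 0 <= a0 by case/andP: pc01 => pc0 _; apply: le_trans pc0 pc_a.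
have [a01 k0 kappa_a] := sqrt_constant_arith a00 a0_le b_small kappa_ge.
have pc_b : pc <= 1 / 100 / 100 by rewrite (le_trans pc_a) // (le_trans a0_le).
clear b0 bN N2 cube500 X_large cube pcO pcO' b_small pc_a kappa_ge a0_le b N.
set kappa := pc ^+ 2 * _ in k0 kappa_a *.
have sqrt_law g : 0 <= g <= 1 -> 999 / 1000 * ((1 - g) * mag B pc g o ^+ 2) <= 4 * g.
  move=> g01.
  have fk h : 0 < h -> h <= 1 -> kappa * mag B pc h o ^+ 2
      * ((1 - a0) * dry_size B o pc h - 2 * a0 * (mag B pc h o / h)) <= 2 * mag B pc h o.
    move=> h0 h1; exact: fork_inequality.
  apply: le_trans (mag_sqrt pc01 a01 k0 fk g01); rewrite ler_wpM2r //.
  by rewrite mulr_ge0 ?exprn_ge0 ?mag_ge0 // subr_ge0; case/andP: g01.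
have pc_small : pc <= 1 / 1000.
  by apply: le_trans pc_b _; move: (R); clear => K; lra.
have pE : p = pc + eps / Omega%:R by [].
have [EC CH] := cluster_bounds bondB transB degB pc01 p01 pc_small Om0 eps0 pE L1 VE sqrt_law X_small.
have L2 : 0 < L ^+ 2 by rewrite exprn_gt0 // (lt_le_trans ltr01).
have eV : 0 <= eps * V by rewrite mulr_ge0.
rewrite V23; split=> // omega omega0; apply: markov_Cmax => //; first exact: ltr_wpDr.
apply: le_trans EC _; rewrite mulrDr addrC mulrA lerD2r ler_wpM2r ?ler_nat //.
exact: ltW.
Qed.
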